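(* Let $d\ge1$ and let $\mu=\mu_{\mathrm{ac}}+\mu_{\mathrm{s}}$ be the nc Lebesgue decomposition of a non-trivial probability nc measure $\mu$ on $\mathscr{A}_d$. Then $$\Lambda_\infty(0^{(d)}_{1\times1};\mu)=\Lambda_\infty(0^{(d)}_{1\times1};\mu_{\mathrm{ac}}),$$ where $0^{(d)}_{1\times1}=(0,\dots,0)\in\mathbb{C}^d$.
   Context: $\mathbb{F}_d^+$ is the free monoid on the generators $1,\dots,d$ with identity $\emptyset$, ordered by the shortlex order ($\sigma\prec\tau$ if $|\sigma|<|\tau|$, or if $|\sigma|=|\tau|$ and $\sigma$ precedes $\tau$ lexicographically with $1\prec\cdots\prec d$); for a $d$-tuple $Z$ and a word $\sigma=\sigma_1\cdots\sigma_n$, $Z^\sigma:=Z_{\sigma_1}\cdots Z_{\sigma_n}$, $Z^\emptyset:=1$. $\mathbb{C}\langle Z\rangle$ is the algebra of polynomials in noncommuting variables $Z_1,\dots,Z_d$ with complex coefficients; $Q(0)$ is the constant coefficient of $Q$. The nc Hardy space $\mathbb{H}^2_d$ is the Hilbert space of formal power series $\sum_\sigma c_\sigma Z^\sigma$ with $\sum_\sigma|c_\sigma|^2<\infty$ and orthonormal basis $\{Z^\sigma\}$; $L=(L_1,\dots,L_d)$, $(L_jf)(Z)=Z_jf(Z)$, so $L_j^*L_k=\delta_{jk}I$. $\mathcal{A}_d$ is the operator-norm closure of $\{p(L):p\in\mathbb{C}\langle Z\rangle\}$; its elements $a$ are also regarded as elements $a1$ of $\mathbb{H}^2_d$. $\mathscr{A}_d:=\overline{\mathcal{A}_d+\mathcal{A}_d^*}$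 (operator-norm closure). An nc measure is a linear functional $\mu:\mathscr{A}_d\to\mathbb{C}$ with $\mu(f)\ge0$ for all positive operators $f\in\mathscr{A}_d$. For nc polynomials $P,Q$, $\mu(Q^*P)$ means $\mu(Q(L)^*P(L))$. $\mu$ is a probability nc measure if $\mu(I)=1$, and non-trivial if the matrix $[\mu((L^\tau)^*L^\sigma)]_{\sigma,\tau\preceq\sigma_0}$ is invertible for every $\sigma_0\in\mathbb{F}_d^+$. For an nc measure $\nu$ let $q_\nu(a_1,a_2):=\nu(a_1^*a_2)$, a positive quadratic form in $\mathbb{H}^2_d$ with dense domain $\mathcal{A}_d$. $\nu$ is absolutely continuous if $q_\nu$ is absolutely continuous in the sense of Simon, i.e. closable, and singular if $q_\nu$ is singular in the sense of Simon, i.e. the largest closable positive form bounded above by $q_\nu$ is $0$. The nc Lebesgue decomposition of $\mu$ (Jury–Martin) is the unique decomposition $\mu=\mu_{\mathrm{ac}}+\mu_{\mathrm{s}}$ into nc measures with $\mu_{\mathrm{ac}}$ the maximal absolutely continuous nc measure bounded above by $\mu$ and $\mu_{\mathrm{s}}$ singular. For an nc measure $\nu$, the nc Christoffel function at zero is $\Lambda_\infty(0^{(d)}_{1\times1};\nu):=\inf\{\nu(Q^*Q):Q\in\mathbb{C}\langle Z\rangle,\ Q(0)=1\}$. *)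

(* Defs.v *)
From HB Require Import structures.
From mathcomp Require Import all_boot all_order all_algebra.
From mathcomp Require Import finmap complex.
From mathcomp Require Import all_classical all_reals all_analysis.
From mathcomp Require Import lra.

Set Implicit Arguments.
Unset Strict Implicit.
Unset Printing Implicit Defensive.

Import Order.TTheory GRing.Theory Num.Theory.
Import numFieldNormedType.Exports.
Import ComplexField.Normc.

Local Open Scope classical_set_scope.
Local Open Scope ring_scope.
Local Open Scope complex_scope.

(* The free monoid on d generators: the generator j is [:: j], the product is
   concatenation and the unit is [::]. *)
Notation word d := (seq 'I_d).

Definition shortlex (d : nat) (s t : word d) : bool :=
  (size s < size t)%N ||
  ((size s == size t) && ((s : seqlexi 'I_d) <= t)%O).

Definition words_upto (d : nat) (s0 : word d) : seq (word d) :=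
  [seq s <- flatten [seq [seq tval t | t : n.-tuple 'I_d]
                    | n <- iota 0 (size s0).+1]
  | shortlex s s0].

Section SquareSummable.
Context {R : realType} {d : nat}.
Local Notation C := R[i].
Implicit Types c : word d -> C.

Definition sqsum c : \bar R := \esum_(w in [set: word d]) (normc (c w) ^+ 2)%:E.

Definition sqsummable : {pred (word d -> C)} := fun c => `[< (sqsum c < +oo)%E >].

Lemma normc_sqE (z : C) : normc z ^+ 2 = complex.Re z ^+ 2 + complex.Im z ^+ 2.
Proof. by case: z => a b /=; rewrite sqr_sqrtr // addr_ge0 // sqr_ge0. Qed.

Lemma normcM_sq (a z : C) : normc (a * z) ^+ 2 = normc a ^+ 2 * normc z ^+ 2.
Proof.
rewrite !normc_sqE; case: a => a b; case: z => x y /=.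
by rewrite !expr2; lra.
Qed.

Lemma normcD_sq_le (x y : C) :
  normc (x + y) ^+ 2 <= 2 * normc x ^+ 2 + 2 * normc y ^+ 2.
Proof.
rewrite !normc_sqE; case: x => a b; case: y => a' b' /=.
by have := sqr_ge0 (a - a'); have := sqr_ge0 (b - b'); rewrite !expr2; lra.
Qed.

Lemma sqsum_le c (M : R) :
  (forall F : {fset word d}, \sum_(w <- F) normc (c w) ^+ 2 <= M) ->
  c \in sqsummable.
Proof.
move=> cM; apply/asboolP; apply: (@le_lt_trans _ _ M%:E); last exact: ltry.
apply: ge_ereal_sup => _ [F [finF _] <-].
rewrite fsbig_finite //= sumEFin lee_fin; exact: cM.
Qed.

Lemma sqsum_fset_le c : c \in sqsummable -> forall F : {fset word d},
  \sum_(w <- F) normc (c w) ^+ 2 <= fine (sqsum c).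
Proof.
move=> /asboolP cfin F.
have c0 : (0 <= sqsum c)%E by apply: esum_ge0 => w _; rewrite lee_fin sqr_ge0.
rewrite -lee_fin fineK ?ge0_fin_numE // -sumEFin.
apply: ereal_sup_ubound; exists [set` F]; first by split.
by rewrite fsbig_finite //= set_fsetK.
Qed.

Lemma sqsummable_submod : submod_closed sqsummable.
Proof.
split.
  apply: (@sqsum_le _ 0) => F; rewrite big1 // => w _.
  by rewrite normc_sqE /= !expr0n addr0.
move=> a f g fS gS.
apply: (@sqsum_le _
  (2 * (normc a ^+ 2 * fine (sqsum f)) + 2 * fine (sqsum g))) => F.
apply: (@le_trans _ _ (\sum_(w <- F)
    (2 * (normc a ^+ 2 * normc (f w) ^+ 2) + 2 * normc (g w) ^+ 2))).
  apply: ler_sum => w _; rewrite -normcM_sq; exact: normcD_sq_le.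
rewrite big_split /= -!mulr_sumr.
apply: lerD; rewrite ler_pM2l //; last exact: sqsum_fset_le.
by rewrite ler_wpM2l ?sqr_ge0 //; exact: sqsum_fset_le.
Qed.

HB.instance Definition _ :=
  GRing.isSubmodClosed.Build C (word d -> C) sqsummable sqsummable_submod.

End SquareSummable.

(* The nc Hardy space: a power series is given by its coefficient function. *)
Record hardy (R : realType) (d : nat) := Hardy {
  coef :> word d -> R[i];
  _ : coef \in sqsummable }.

HB.instance Definition _ (R : realType) (d : nat) := [isSub for @coef R d].
HB.instance Definition _ (R : realType) (d : nat) :=
  [Choice of hardy R d by <:].
HB.instance Definition _ (R : realType) (d : nat) :=
  [SubChoice_isSubLmodule of hardy R d by <:].

Section HardySpace.
Context {R : realType} {d : nat}.
Local Notation C := R[i].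
Local Notation H := (hardy R d).
Implicit Types f g : H.

(* Unordered sums over all words; meaningful for absolutely summable
   families. *)
Definition rsum (u : word d -> R) : R :=
  fine (\esum_(w in [set: word d]) ((EFin \o u)^\+ w)%E) -
  fine (\esum_(w in [set: word d]) ((EFin \o u)^\- w)%E).

Definition csum (c : word d -> C) : C :=
  rsum (fun w => complex.Re (c w)) +i* rsum (fun w => complex.Im (c w)).

(* Conjugate-linear in the first argument. *)
Definition inner f g : C := csum (fun w => (f w)^* * g w).

Definition hnorm f : R := Num.sqrt (fine (sqsum f)).

Lemma monomial_subproof (v : word d) :
  (fun w => (w == v)%:R : C) \in sqsummable.
Proof.
apply: (@sqsum_le _ _ _ 1) => F.
have E w : normc ((w == v)%:R : C) ^+ 2 = (w == v)%:R :> R.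
  by rewrite normc_sqE; case: (w == v); rewrite /= !expr2 !(mulr0, mulr1, addr0).
under eq_bigr do rewrite E.
have [vF|vF] := boolP (v \in F); last first.
  rewrite big_seq big1 // => w wF; case: eqP => // wv.
  by rewrite -wv wF in vF.
rewrite (big_fsetD1 v) //= eqxx big_seq big1 ?addr0 // => w.
by rewrite in_fsetD1 => /andP[/negbTE ->].
Qed.

Definition monomial (v : word d) : H := Hardy (monomial_subproof v).

Definition hone : H := monomial [::].

Definition shift_coef (j : 'I_d) (c : word d -> C) : word d -> C :=
  fun w => if w is k :: v then (if k == j then c v else 0) else 0.

Lemma shift_subproof (j : 'I_d) (f : H) : shift_coef j f \in sqsummable.
Proof.
apply: (@sqsum_le _ _ _ (fine (sqsum f))) => F.
have fS : coef f \in sqsummable by case: f.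
pose P (w : word d) := ohead w == Some j.
pose G : {fset word d} := [fset behead w | w in [fset w in F | P w]]%fset.
apply: le_trans (sqsum_fset_le fS G).
have out w : ~~ P w -> normc (shift_coef j f w) ^+ 2 = 0.
  rewrite normc_sqE; case: w => [_|k v] /=; first by rewrite !expr0n addr0.
  by rewrite /P /= (inj_eq (@Some_inj _)) => /negbTE -> /=; rewrite !expr0n addr0.
rewrite (bigID P) /= [X in _ + X]big1 // addr0.
rewrite /G big_imfset /=; last first.
  move=> [|k v] [|k' v']; rewrite !inE /P /= ?andbF //.
  by move=> /andP[_ /eqP[->]] /andP[_ /eqP[->]] ->.
rewrite big_fset_condE /= big_seq [leRHS]big_seq.
apply: ler_sum => -[|k v]; rewrite !inE /P /= ?andbF // => /andP[_ /eqP[->]].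
by rewrite eqxx.
Qed.

Definition shift (j : 'I_d) (f : H) : H := Hardy (shift_subproof j f).

Definition shiftw (s : word d) : H -> H :=
  foldr (fun j T => shift j \o T) idfun s.

Definition bounded_op : set (H -> H) :=
  [set T | linear T /\ exists M : R, forall f, hnorm (T f) <= M * hnorm f].

Definition opnorm (T : H -> H) : R :=
  sup [set hnorm (T f) | f in [set f | hnorm f <= 1]].

Definition opclosure (X : set (H -> H)) : set (H -> H) :=
  [set T | bounded_op T /\
    forall e : R, 0 < e -> exists2 S, X S & opnorm (T - S) < e].

Definition is_adjoint (T S : H -> H) : Prop :=
  forall f g, inner (T f) g = inner f (S g).

(* Every bounded operator has a unique bounded adjoint. *)
Definition adj (T : H -> H) : H -> H :=
  xget 0 [set S | bounded_op S /\ is_adjoint T S].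

Definition positive_op (T : H -> H) : Prop :=
  bounded_op T /\ forall f, 0 <= inner f (T f).

(* The vector space underlying the algebra of nc polynomials: finitely
   supported families of coefficients. The constant coefficient of Q
   is Q [::]. *)
Definition ncpoly : Type := {fsfun word d -> C with 0}.

Definition evalL (Q : ncpoly) : H -> H :=
  \sum_(w <- finsupp Q) Q w *: shiftw w.

Definition disk_algebra : set (H -> H) := opclosure (range evalL).

Definition disk_system : set (H -> H) :=
  opclosure [set a + b | a in disk_algebra & b in adj @` disk_algebra].

(* Functionals on disk_system are represented by functions on all maps H -> H;
   only their values on disk_system are ever constrained or used. *)
Definition nc_measure (mu : (H -> H) -> C) : Prop :=
  (forall (a : C) S T, disk_system S -> disk_system T ->
     mu (a *: S + T) = a * mu S + mu T) /\
  (forall T, disk_system T -> positive_op T -> 0 <= mu T).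

Definition nc_measure_le (nu mu : (H -> H) -> C) : Prop :=
  forall T, disk_system T -> positive_op T -> nu T <= mu T.

Definition nontrivial (mu : (H -> H) -> C) : Prop :=
  forall s0 : word d, let W := words_upto s0 in
  \matrix_(i < size W, j < size W)
     mu (adj (shiftw (nth [::] W j)) \o shiftw (nth [::] W i)) \in unitmx.

(* A sesquilinear form in H, conjugate-linear in its first argument, with
   domain fdom; its values off the domain are irrelevant. *)
Record qform := QForm { fdom : set H; fval : H -> H -> C }.

Definition positive_form (q : qform) : Prop :=
  [/\ fdom q 0,
      forall (a : C) f g, fdom q f -> fdom q g -> fdom q (a *: f + g),
      forall (a : C) f g h, fdom q f -> fdom q g -> fdom q h ->
        fval q h (a *: f + g) = a * fval q h f + fval q h g,
      forall (a : C) f g h, fdom q f -> fdom q g -> fdom q h ->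
        fval q (a *: f + g) h = a^* * fval q f h + fval q g h
    & forall f, fdom q f -> 0 <= fval q f f].

Definition form_le (p q : qform) : Prop :=
  fdom q `<=` fdom p /\ forall f, fdom q f -> fval p f f <= fval q f f.

Definition form_norm (q : qform) (f : H) : R :=
  Num.sqrt (complex.Re (fval q f f) + hnorm f ^+ 2).

Definition closed_form (q : qform) : Prop :=
  forall u : nat -> H, (forall n, fdom q (u n)) ->
  (forall e : R, 0 < e -> exists N, forall m n, (N <= m)%N -> (N <= n)%N ->
     form_norm q (u m - u n) < e) ->
  exists2 f, fdom q f & form_norm q (u n - f) @[n --> \oo] --> (0 : R).

Definition form_extends (p q : qform) : Prop :=
  fdom q `<=` fdom p /\
  forall f g, fdom q f -> fdom q g -> fval p f g = fval q f g.

Definition closable_form (q : qform) : Prop :=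
  exists p, [/\ positive_form p, closed_form p & form_extends p q].

Definition largest_closable_below (q p : qform) : Prop :=
  [/\ positive_form p, closable_form p, form_le p q &
      forall p', positive_form p' -> closable_form p' -> form_le p' q ->
        form_le p' p].

Definition singular_form (q : qform) : Prop :=
  largest_closable_below q (QForm (fdom q) (fun _ _ => 0)).

(* The element a of the algebra with a 1 = f; it is unique since a commutes
   with right multiplications. *)
Definition symbol_op (f : H) : H -> H :=
  xget 0 [set a | disk_algebra a /\ a hone = f].

Definition measure_form (nu : (H -> H) -> C) : qform :=
  QForm [set a hone | a in disk_algebra]
       (fun f g => nu (adj (symbol_op f) \o symbol_op g)).

Definition nc_ac (nu : (H -> H) -> C) : Prop := closable_form (measure_form nu).

Definition nc_singular (nu : (H -> H) -> C) : Prop :=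
  singular_form (measure_form nu).

Definition nc_lebesgue_decomposition (mu mu_ac mu_s : (H -> H) -> C) : Prop :=
  [/\ nc_measure mu_ac /\ nc_measure mu_s,
      forall T, disk_system T -> mu T = mu_ac T + mu_s T,
      nc_ac mu_ac /\ nc_measure_le mu_ac mu,
      forall nu, nc_measure nu -> nc_ac nu -> nc_measure_le nu mu ->
        nc_measure_le nu mu_ac
    & nc_singular mu_s].

(* The set is nonempty and its elements are nonnegative reals. *)
Definition christoffel0 (nu : (H -> H) -> C) : R :=
  inf [set complex.Re (nu (adj (evalL Q) \o evalL Q))
      | Q in [set Q : ncpoly | Q [::] = 1]].

End HardySpace.

(* Main.v *)
(* The singular part plays no role: it suffices to find an absolutely continuous
   nc measure nu <= mu with the same Christoffel number lam at zero, because
   maximality gives nu <= mu_ac <= mu. Assume lam > 0. In the GNS space of mu the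
   left multiplications by L_1, ..., L_d are isometries with orthogonal ranges,
   and minimizing polynomials w_k with w_k(0) = 1 converge to a wandering vector
   w of norm sqrt lam. The Wold projection P onto the span of the translates L^s
   w commutes with the row isometry, and x |-> (<L^s w, x> / sqrt lam)_s
   identifies its range with the Hardy space, intertwining the two shifts. If h
   is the image of 1, then nu(T) := <h, T h> is an nc measure below mu, since for
   a positive T in the disk system, <1, T 1> is the sum of the contributions of P
   1 and of 1 - P 1, both nonnegative. It is absolutely continuous because its
   form a |-> |a h|^2 is closed on its maximal domain, multiplication by the
   power series h being continuous coefficientwise. Finally nu(Q^* Q) = |Q h|^2
   >= |Q(0) h_0|^2 = lam whenever Q(0) = 1. *)

Require Import Defs.
From HB Require Import structures.
From mathcomp Require Import all_boot all_order all_algebra.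
From mathcomp Require Import finmap complex.
From mathcomp Require Import all_classical all_reals all_analysis.
From mathcomp Require Import showcase.summability.
From mathcomp Require Import ring lra.

Set Implicit Arguments.
Unset Strict Implicit.
Unset Printing Implicit Defensive.

Import Order.TTheory GRing.Theory Num.Theory.
Import numFieldNormedType.Exports.
Import ComplexField.Normc.

Local Open Scope classical_set_scope.
Local Open Scope complex_scope.
Local Open Scope ring_scope.

(* MathComp-Analysis has a translation of the same name. *)
Local Notation shift := Defs.shift.

(** * Complex numbers, semi-inner products and limits *)

(** The GNS space is never completed. The wandering vector is present only through the numbers
    [phi (wordop s (w k)) x] and their limits [ell s x], and the Wold projection only through the
    coefficients of [wold_map x]. Statements about the projection are proved for finite combinations
    [lift r k] of translates of [w k], letting [k] grow.

    The limit of [w] is wandering because minimality makes it represent [lam] times the constant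
    coefficient, a functional that vanishes on the ranges of all left multiplications.

    The other obstacle is that a positive [T] of the disk system need not act on polynomials by left
    multiplication, so it has no compression to compare with. It is squeezed between operators
    [P + P^*] with [P] a polynomial. Positivity of [P + P^*] says that [P] has nonnegative real part
    in the GNS form, and this survives compression since [P] does act. *)

Section ComplexFacts.
Variable R : realType.
Local Notation C := R[i].
Implicit Types (z w : C) (x : R).

Lemma conjE z : z^* = conjc z. Proof. by []. Qed.

Lemma conj_real x : (x%:C)^* = x%:C.
Proof. by rewrite conjE conjc_real. Qed.

Lemma ReN z : complex.Re (- z) = - complex.Re z.
Proof. by case: z. Qed.

Lemma ReD z w : complex.Re (z + w) = complex.Re z + complex.Re w.
Proof. by case: z w => a b []. Qed.

Lemma ReB z w : complex.Re (z - w) = complex.Re z - complex.Re w.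
Proof. by rewrite ReD ReN. Qed.

Lemma normcB_le z w : normc (z - w) <= normc z + normc w.
Proof. by apply: le_trans (le_normcD _ _) _; rewrite normcN. Qed.

Lemma normc_ge0 z : 0 <= normc z.
Proof. by case: z => a b; exact: sqrtr_ge0. Qed.

Lemma normc_conj z : normc (z^*)%R = normc z.
Proof. by rewrite conjE; case: z => a b /=; rewrite sqrrN. Qed.

Lemma normc_real x : normc x%:C = `|x|.
Proof. by rewrite /= expr0n addr0 sqrtr_sqr. Qed.

Lemma Re_le_normc z : complex.Re z <= normc z.
Proof.
case: z => a b /=; apply: le_trans (ler_norm _) _.
by rewrite -sqrtr_sqr ler_wsqrtr // lerDl sqr_ge0.
Qed.

Lemma absRe_le_normc z : `|complex.Re z| <= normc z.
Proof. by rewrite ler_norml lerNl -ReN -{1}normcN !Re_le_normc. Qed.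

Lemma absIm_le_normc z : `|complex.Im z| <= normc z.
Proof.
by case: z => a b /=; rewrite -sqrtr_sqr ler_wsqrtr // lerDr sqr_ge0.
Qed.

Lemma normc_le_ReIm z : normc z <= `|complex.Re z| + `|complex.Im z|.
Proof.
case: z => a b /=; rewrite -[leRHS]ger0_norm ?addr_ge0 // -sqrtr_sqr.
rewrite ler_wsqrtr // sqrrD !real_normK ?num_real //.
by rewrite lerD2r lerDl mulrn_wge0 // mulr_ge0.
Qed.

Lemma mul_conjc z : z^* * z = (normc z ^+ 2)%:C.
Proof.
rewrite conjE normc_sqE; case: z => a b /=; apply/eqP; rewrite eq_complex /=.
by apply/andP; split; apply/eqP; ring.
Qed.

Lemma ReJ z : complex.Re (z^*)%R = complex.Re z.
Proof. by rewrite conjE; case: z. Qed.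

Lemma ge0_realE z : 0 <= z -> z = (complex.Re z)%:C.
Proof. by case: z => a b; rewrite lecE /= => /andP[/eqP ->]. Qed.

Lemma ge0_Re z : 0 <= z -> 0 <= complex.Re z.
Proof. by rewrite lecE /= => /andP[]. Qed.

Lemma ge0_le_Re z w : 0 <= z -> 0 <= w ->
  (z <= w) = (complex.Re z <= complex.Re w).
Proof.
by move=> /ge0_realE -> /ge0_realE ->; rewrite lecR.
Qed.

Lemma Re_mulC x z : complex.Re (x%:C * z) = x * complex.Re z.
Proof. by case: z => a b /=; rewrite mul0r subr0. Qed.

Lemma ler_sqr_normc z x : 0 <= x -> normc z ^+ 2 <= x ^+ 2 -> normc z <= x.
Proof. by move=> x0; rewrite ler_sqr ?nnegrE ?normc_ge0. Qed.

(** The discriminant argument behind Cauchy-Schwarz. Taking [t = - s z^*] with [s] real leaves a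
    real quadratic in [s], evaluated at [s = 1 / m]; the case [m = 0] is kept because the forms
    below may be degenerate. *)
Lemma quadratic_ineq (a m : R) z : 0 <= m ->
  (forall t : C, 0 <= a + 2 * complex.Re (t * z) + normc t ^+ 2 * m) ->
  normc z ^+ 2 <= a * m.
Proof.
move=> m0 H; set n := normc z ^+ 2.
have {}H (s : R) : 0 <= a - 2 * s * n + s ^+ 2 * n * m.
  have := H (- (s%:C * z^*)).
  rewrite mulNr -[_ * z]mulrA mul_conjc ReN Re_mulC normcN normcM_sq normc_conj.
  rewrite normc_real -normrX ger0_norm ?sqr_ge0 // -/n /=; lra.
have n0 : 0 <= n by rewrite sqr_ge0.
move: m0; rewrite le0r => /orP[/eqP m0|m0].
  rewrite m0 mulr0; move: n0; rewrite le0r => /orP[/eqP ->//|n0].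
  (* For [m = 0] the quadratic is affine in [s], and this [s] gives it the value [-1]. *)
  have := H ((a + 1) / (2 * n)).
  rewrite m0 mulr0 addr0 (_ : a - _ = -1); first by rewrite ler0N1.
  by field; rewrite gt_eqF.
have := H m^-1.
rewrite (_ : _ + _ = a - n / m); last by field; rewrite gt_eqF.
by rewrite subr_ge0 ler_pdivrMr.
Qed.

End ComplexFacts.

Section Sesquilinear.
Context {R : realType} {V : lmodType R[i]}.
Local Notation C := R[i].

(** Definiteness is not demanded, so that one theory covers the Hardy inner product, the GNS form of
    a measure and the form [defect]; Hermitian symmetry is derived from positivity. *)
Record semi_inner (B : V -> V -> C) : Prop := SemiInner {
  semi_innerPr : forall (a : C) x y z, B z (a *: x + y) = a * B z x + B z y;
  semi_innerPl : forall (a : C) x y z, B (a *: x + y) z = a^* * B x z + B y z;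
  semi_inner_ge0 : forall x, 0 <= B x x }.

Definition semi_norm (B : V -> V -> C) x : R := Num.sqrt (complex.Re (B x x)).

Variable B : V -> V -> C.
Hypothesis hB : semi_inner B.
Local Notation N := (semi_norm B).

Lemma semi_inner0r z : B z 0 = 0.
Proof.
have := semi_innerPr hB 1 0 0 z; rewrite scaler0 addr0 mul1r => /esym/eqP.
by rewrite -subr_eq0 addrK => /eqP.
Qed.

Lemma semi_inner0l z : B 0 z = 0.
Proof.
have := semi_innerPl hB 1 0 0 z; rewrite scaler0 addr0 rmorph1 mul1r.
by move=> /esym/eqP; rewrite -subr_eq0 addrK => /eqP.
Qed.

Lemma semi_innerDr x y z : B z (x + y) = B z x + B z y.
Proof. by have := semi_innerPr hB 1 x y z; rewrite scale1r mul1r. Qed.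

Lemma semi_innerDl x y z : B (x + y) z = B x z + B y z.
Proof. by have := semi_innerPl hB 1 x y z; rewrite scale1r rmorph1 mul1r. Qed.

Lemma semi_innerZr a x z : B z (a *: x) = a * B z x.
Proof. by have := semi_innerPr hB a x 0 z; rewrite semi_inner0r !addr0. Qed.

Lemma semi_innerZl a x z : B (a *: x) z = a^* * B x z.
Proof. by have := semi_innerPl hB a x 0 z; rewrite semi_inner0l !addr0. Qed.

Lemma semi_innerNr x z : B z (- x) = - B z x.
Proof. by rewrite -scaleN1r semi_innerZr mulN1r. Qed.

Lemma semi_innerNl x z : B (- x) z = - B x z.
Proof. by rewrite -scaleN1r semi_innerZl rmorphN1 mulN1r. Qed.

Lemma semi_innerBr x y z : B z (x - y) = B z x - B z y.
Proof. by rewrite semi_innerDr semi_innerNr. Qed.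

Lemma semi_innerBl x y z : B (x - y) z = B x z - B y z.
Proof. by rewrite semi_innerDl semi_innerNl. Qed.

Lemma semi_inner_sumr I (r : seq I) (F : I -> V) z :
  B z (\sum_(i <- r) F i) = \sum_(i <- r) B z (F i).
Proof. by apply: big_morph; [move=> x y; exact: semi_innerDr|exact: semi_inner0r]. Qed.

Lemma semi_inner_suml I (r : seq I) (F : I -> V) z :
  B (\sum_(i <- r) F i) z = \sum_(i <- r) B (F i) z.
Proof.
by apply: (big_morph (B^~ z)); [move=> x y; exact: semi_innerDl|exact: semi_inner0l].
Qed.

(** Positivity makes the form real at [x + y] and at [x + 'i *: y]; these facts compare,
    respectively, the imaginary and the real parts of [B x y] and [B y x]. *)
Lemma semi_innerC x y : B y x = (B x y)^*.
Proof.
have Im0 v : complex.Im (B v v) = 0 by apply: ger0_Im; exact: semi_inner_ge0.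
have := Im0 (x + y); have := Im0 (x + 'i%C *: y).
rewrite !(semi_innerDr, semi_innerDl, semi_innerZr, semi_innerZl) !conjE.
move: (Im0 x) (Im0 y).
case: (B x x) (B y y) (B x y) (B y x) => [a a'] [b b'] [c c'] [e e'] /= -> ->.
rewrite !(mul0r, mul1r, addr0, add0r, subr0, sub0r, oppr0, mulr0, mulN1r, opprK).
move=> H1 H2; apply/eqP; rewrite eq_complex /=.
by apply/andP; split; apply/eqP; lra.
Qed.

Lemma semi_inner_realE x : B x x = (complex.Re (B x x))%:C.
Proof. by apply: ge0_realE; exact: semi_inner_ge0. Qed.

Lemma semi_inner_Re_ge0 x : 0 <= complex.Re (B x x).
Proof. by apply: ge0_Re; exact: semi_inner_ge0. Qed.

Lemma sqr_semi_norm x : N x ^+ 2 = complex.Re (B x x).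
Proof. by rewrite sqr_sqrtr // semi_inner_Re_ge0. Qed.

Lemma semi_norm_ge0 x : 0 <= N x.
Proof. exact: sqrtr_ge0. Qed.

Lemma ReD_semi_inner x y : complex.Re (B (x + y) (x + y)) =
  complex.Re (B x x) + 2 * complex.Re (B x y) + complex.Re (B y y).
Proof.
rewrite !(semi_innerDr, semi_innerDl) !ReD (semi_innerC x y) ReJ; ring.
Qed.

Lemma cauchy_schwarz x y : normc (B x y) <= N x * N y.
Proof.
apply: ler_sqr_normc; first by rewrite mulr_ge0 ?semi_norm_ge0.
rewrite exprMn !sqr_semi_norm.
apply: quadratic_ineq; first exact: semi_inner_Re_ge0.
move=> t; have := semi_inner_Re_ge0 (x + t *: y).
rewrite ReD_semi_inner !semi_innerZr semi_innerZl mulrA.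
by rewrite [t * t^*]mulrC mul_conjc Re_mulC.
Qed.

Lemma semi_normD x y : N (x + y) <= N x + N y.
Proof.
rewrite -ler_sqr ?nnegrE ?addr_ge0 ?semi_norm_ge0 // sqrrD !sqr_semi_norm.
rewrite ReD_semi_inner lerD2r lerD2l mulr2n mulrDl mul1r lerD //;
  exact: le_trans (Re_le_normc _) (cauchy_schwarz _ _).
Qed.

Lemma semi_normZ a x : N (a *: x) = normc a * N x.
Proof.
rewrite /semi_norm semi_innerZr semi_innerZl mulrA [a * _]mulrC mul_conjc.
by rewrite Re_mulC sqrtrM ?sqr_ge0 // sqrtr_sqr ger0_norm ?normc_ge0.
Qed.

Lemma semi_normN x : N (- x) = N x.
Proof. by rewrite -scaleN1r semi_normZ normcN normc1 mul1r. Qed.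

Lemma semi_norm0 : N 0 = 0.
Proof. by rewrite /semi_norm semi_inner0r sqrtr0. Qed.

Lemma semi_normB x y : N (x - y) <= N x + N y.
Proof. by rewrite -[leRHS]/(_ + _) -(semi_normN y) semi_normD. Qed.

End Sesquilinear.

Section ComplexLimits.
Context {R : realType} {I : Type} (F : set_system I).
Local Notation C := R[i].
Implicit Types (u v : I -> C) (l m : C).

(** Generic in the filter, to serve both sequences (along [\oo]) and unordered sums over words
    (along [totally]). *)
Definition climit u l : Prop :=
  forall e : R, 0 < e -> \forall i \near F, normc (u i - l) < e.

Context {FF : Filter F}.

Lemma climit_cst l : climit (fun=> l) l.
Proof. by move=> e e0; apply: nearW => i; rewrite subrr normc0. Qed.

Lemma climit_ext u v l : (forall i, u i = v i) -> climit u l -> climit v l.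
Proof. by move=> /funext ->. Qed.

Lemma climitD u v l m :
  climit u l -> climit v m -> climit (fun i => u i + v i) (l + m).
Proof.
move=> ul vm e e0; have e20 : 0 < e / 2 by rewrite divr_gt0.
near=> i; rewrite opprD addrACA.
apply: le_lt_trans (le_normcD _ _) _; rewrite [ltRHS]splitr ltrD //.
  by near: i; exact: ul.
by near: i; exact: vm.
Unshelve. all: by end_near. Qed.

Lemma climitM a u l : climit u l -> climit (fun i => a * u i) (a * l).
Proof.
move=> ul e e0.
have a1 : 0 < normc a + 1 by rewrite ltr_wpDl ?normc_ge0.
have e20 : 0 < e / (normc a + 1) by rewrite divr_gt0.
near=> i; rewrite -mulrBr normcM.
apply: (@le_lt_trans _ _ ((normc a + 1) * normc (u i - l))).
  by rewrite ler_wpM2r ?normc_ge0 // lerDl.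
rewrite mulrC -ltr_pdivlMr //.
by near: i; exact: ul.
Unshelve. all: by end_near. Qed.

Lemma climitN u l : climit u l -> climit (fun i => - u i) (- l).
Proof.
by move=> /(climitM (-1)); rewrite mulN1r; apply: climit_ext => i; rewrite mulN1r.
Qed.

Lemma climitB u v l m :
  climit u l -> climit v m -> climit (fun i => u i - v i) (l - m).
Proof. by move=> ul /climitN; exact: climitD. Qed.

Lemma climit_conj u l : climit u l -> climit (fun i => (u i)^*) l^*.
Proof.
move=> ul e e0; near=> i; rewrite -rmorphB normc_conj.
by near: i; exact: ul.
Unshelve. all: by end_near. Qed.

Lemma climit_mul u v l m :
  climit u l -> climit v m -> climit (fun i => u i * v i) (l * m).
Proof.
move=> ul vm.
(* Expanding around the limits avoids any bound on [u] or [v]: one factor is made smaller than 1,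
   the other smaller than [e]. *)
have uv0 : climit (fun i => (u i - l) * (v i - m)) 0.
  move=> e e0; near=> i; rewrite subr0 normcM -[e]mul1r.
  rewrite ltr_pM ?normc_ge0 //.
    by near: i; exact: ul.
  by near: i; exact: vm.
have := climitD uv0 (climitB (climitD (climitM l vm) (climitM m ul)) (climit_cst (l * m))).
rewrite (_ : 0 + _ = l * m); last by ring.
by apply: climit_ext => i; ring.
Unshelve. all: by end_near. Qed.

Lemma climit_sum J (r : seq J) (u : J -> I -> C) (l : J -> C) :
  (forall j, climit (u j) (l j)) ->
  climit (fun i => \sum_(j <- r) u j i) (\sum_(j <- r) l j).
Proof.
move=> ul; elim: r => [|j r IH].
  by rewrite big_nil; apply: climit_ext (climit_cst 0) => i; rewrite big_nil.
rewrite big_cons; apply: climit_ext (climitD (ul j) IH) => i.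
by rewrite big_cons.
Qed.

End ComplexLimits.

(* The library declares it inside a section only. *)
#[local] Existing Instance totally_filter.

(** * The Hardy space as a Hilbert space *)

Section UnorderedSums.
Context {R : realType} {d : nat}.
Local Notation C := R[i].
Local Notation H := (hardy R d).
Implicit Types (f g h : H) (F : {fset word d}).

Lemma near_totally (A : {fset word d}) (P : {fset word d} -> Prop) :
  (forall F, (A `<=` F)%fset -> P F) -> \forall F \near totally, P F.
Proof. by move=> AP; exists A => // F; exact: AP. Qed.

Lemma climit_uniq I (G : set_system I) {GG : ProperFilter G} (u : I -> C) l m :
  climit G u l -> climit G u m -> l = m.
Proof.
move=> ul um; apply/eqP; rewrite -subr_eq0; apply/eqP/eq0_normc/le_anti.
rewrite normc_ge0 andbT; apply/ler_addgt0Pr => e e0; rewrite add0r.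
have e20 : 0 < e / 2 by rewrite divr_gt0.
have [k] : exists k, normc (u k - l) < e / 2 /\ normc (u k - m) < e / 2.
  by apply: (@filter_ex _ G); apply: filterI; [exact: ul|exact: um].
move=> [il im]; rewrite (_ : l - m = (u k - m) - (u k - l)); last by ring.
apply: le_trans (normcB_le _ _) _.
by rewrite [leRHS]splitr lerD // ltW.
Qed.

Lemma climit_Re_ge0 I (G : set_system I) {GG : ProperFilter G} (u : I -> C) l :
  climit G u l -> (\forall i \near G, 0 <= complex.Re (u i)) ->
  0 <= complex.Re l.
Proof.
move=> ul u0; apply/ler_addgt0Pr => e e0.
have [k [il k0]] := filter_ex (filterI (ul _ e0) u0).
apply: le_trans k0 _; rewrite -lerBlDl -ReB.
exact: le_trans (Re_le_normc _) (ltW il).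
Qed.

Lemma climit_Re_le I (G : set_system I) {GG : ProperFilter G} (u : I -> C) l M :
  climit G u l -> (\forall i \near G, complex.Re (u i) <= M) ->
  complex.Re l <= M.
Proof.
move=> ul uM; rewrite -subr_ge0 -[M]/(complex.Re M%:C) -ReB.
apply: (climit_Re_ge0 (climitB (climit_cst M%:C) ul)).
by apply: filterS uM => k; rewrite ReB subr_ge0.
Qed.

Lemma fset_sum_subset F (F' : {fset word d}) (v : word d -> R) :
  (F `<=` F')%fset -> (forall w, 0 <= v w) ->
  \sum_(w <- F) v w <= \sum_(w <- F') v w.
Proof.
move=> FF' v0; rewrite [leRHS](big_fsetID _ (mem F)) /=.
rewrite (_ : [fset x in F' | x \in F]%fset = F); first by rewrite lerDl sumr_ge0.
by apply/fsetP => x; rewrite !inE andbC; case: (boolP (x \in F)) => // /(fsubsetP FF').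
Qed.

Lemma ge0_esum_climit (v : word d -> R) (M : R) : (forall w, 0 <= v w) ->
  (forall F, \sum_(w <- F) v w <= M) -> forall e : R, 0 < e ->
  \forall F \near totally,
    `|\sum_(w <- (F : {fset _})) v w - fine (\esum_(w in [set: word d]) (v w)%:E)| < e.
Proof.
move=> v0 vM e e0; set s := esum _ _.
have sM : (s <= M%:E)%E.
  apply: ge_ereal_sup => _ [F [finF _] <-].
  by rewrite fsbig_finite //= sumEFin lee_fin.
have s0 : (0 <= s)%E by apply: esum_ge0 => w _; rewrite lee_fin.
have sfin : s \is a fin_num by rewrite ge0_fin_numE // (le_lt_trans sM) // ltry.
have le_s F : \sum_(w <- F) v w <= fine s.
  rewrite -lee_fin fineK // -sumEFin; apply: ereal_sup_ubound.
  by exists [set` F]; [split|rewrite fsbig_finite //= set_fsetK].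
have [_ [A [finA _] <-]] := ub_ereal_sup_adherent e0 sfin.
rewrite fsbig_finite //= sumEFin => sA.
have {}sA : fine s - e < \sum_(w <- fset_set A) v w.
  by rewrite -lte_fin EFinB fineK.
apply: (@near_totally (fset_set A)) => F AF.
rewrite ler0_norm ?subr_le0 // opprB ltrBlDl -ltrBlDr.
exact: lt_le_trans sA (fset_sum_subset AF v0).
Qed.

Lemma rsum_climit (u : word d -> R) (M : R) :
  (forall F, \sum_(w <- F) `|u w| <= M) -> forall e : R, 0 < e ->
  \forall F \near totally, `|\sum_(w <- (F : {fset _})) u w - rsum u| < e.
Proof.
move=> uM e e0; have e20 : 0 < e / 2 by rewrite divr_gt0.
have posM F : \sum_(w <- F) Num.max (u w) 0 <= M.
  apply: le_trans (uM F); apply: ler_sum => w _.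
  by rewrite ge_max ler_norm normr_ge0.
have negM F : \sum_(w <- F) Num.max (- u w) 0 <= M.
  apply: le_trans (uM F); apply: ler_sum => w _.
  by rewrite ge_max -normrN ler_norm normr_ge0.
have p0 w : 0 <= Num.max (u w) 0 by rewrite le_max lexx orbT.
have n0 w : 0 <= Num.max (- u w) 0 by rewrite le_max lexx orbT.
rewrite /rsum.
rewrite (_ : esum _ (_^\+)%E = \esum_(w in [set: word d]) (Num.max (u w) 0)%:E); last first.
  by apply: eq_esum => w _; rewrite funeposE /= EFin_max.
rewrite (_ : esum _ (_^\-)%E = \esum_(w in [set: word d]) (Num.max (- u w) 0)%:E); last first.
  by apply: eq_esum => w _; rewrite funenegE /= EFin_max.
have P := ge0_esum_climit p0 posM e20; have N := ge0_esum_climit n0 negM e20.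
near=> F; rewrite (eq_bigr (fun w => Num.max (u w) 0 - Num.max (- u w) 0)); last first.
  by move=> w _; rewrite /Num.max; case: ltP => ?; case: ltP => ?; lra.
rewrite sumrB opprB [X in _ + X]addrC addrACA [ltRHS]splitr.
apply: le_lt_trans (ler_normD _ _) _; rewrite ltrD //.
  by near: F; exact: P.
by rewrite addrC distrC; near: F; exact: N.
Unshelve. all: by end_near. Qed.

Lemma Re_sum I (r : seq I) (c : I -> C) :
  complex.Re (\sum_(i <- r) c i) = \sum_(i <- r) complex.Re (c i).
Proof. exact: (big_morph _ (@ReD R) (erefl : complex.Re (0 : C) = 0)). Qed.

Lemma Im_sum I (r : seq I) (c : I -> C) :
  complex.Im (\sum_(i <- r) c i) = \sum_(i <- r) complex.Im (c i).
Proof. by apply: (big_morph (@complex.Im R)) => // -[a b] []. Qed.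

Lemma csum_climit (c : word d -> C) (M : R) :
  (forall F, \sum_(w <- F) normc (c w) <= M) ->
  climit totally (fun F : {fset _} => \sum_(w <- F) c w) (csum c).
Proof.
move=> cM e e0; have e20 : 0 < e / 2 by rewrite divr_gt0.
have reM F : \sum_(w <- F) `|complex.Re (c w)| <= M.
  by apply: le_trans (cM F); apply: ler_sum => w _; exact: absRe_le_normc.
have imM F : \sum_(w <- F) `|complex.Im (c w)| <= M.
  by apply: le_trans (cM F); apply: ler_sum => w _; exact: absIm_le_normc.
have Rel := rsum_climit reM e20; have Iml := rsum_climit imM e20.
near=> F; apply: le_lt_trans (normc_le_ReIm _) _.
have ImB (z t : C) : complex.Im (z - t) = complex.Im z - complex.Im t.
  by case: z t => ? ? [].
rewrite ReB ImB Re_sum Im_sum [ltRHS]splitr ltrD //.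
  by near: F; exact: Rel.
by near: F; exact: Iml.
Unshelve. all: by end_near. Qed.

Lemma hardy_sqsummable f : coef f \in sqsummable. Proof. by case: f. Qed.

Lemma inner_climit f g :
  climit totally (fun F : {fset _} => \sum_(w <- F) (f w)^* * g w) (inner f g).
Proof.
apply: (@csum_climit _ (fine (sqsum f) + fine (sqsum g))) => F.
apply: le_trans (lerD (sqsum_fset_le (hardy_sqsummable f) F)
  (sqsum_fset_le (hardy_sqsummable g) F)).
rewrite -big_split; apply: ler_sum => w _; rewrite normcM normc_conj.
have := normc_ge0 (f w); have := normc_ge0 (g w).
by move: (normc (f w)) (normc (g w)) => a b a0 b0 /=; nra.
Qed.

Lemma coefD f g w : (f + g) w = f w + g w. Proof. by []. Qed.
Lemma coefZ a f w : (a *: f) w = a * f w. Proof. by []. Qed.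
Lemma coefB f g w : (f - g) w = f w - g w. Proof. by []. Qed.
Lemma coef0 w : (0 : H) w = 0. Proof. by []. Qed.
Lemma coef_sum I (r : seq I) (g : I -> H) w :
  (\sum_(i <- r) g i) w = \sum_(i <- r) g i w.
Proof. exact: (big_morph (fun f : H => f w) (fun f g => coefD f g w)). Qed.

Lemma hardyP f g : (forall w, f w = g w) -> f = g.
Proof. by move=> fg; apply: val_inj; apply/funext. Qed.

Lemma inner_self f : inner f f = (fine (sqsum f))%:C.
Proof.
apply: (climit_uniq (inner_climit f f)) => e e0.
have := ge0_esum_climit _ (sqsum_fset_le (hardy_sqsummable f)) e0.
move=> /(_ (fun w => sqr_ge0 _)); apply: filterS => F.
rewrite (eq_bigr (fun w => (normc (f w) ^+ 2)%:C)); last by move=> w _; exact: mul_conjc.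
by rewrite -rmorph_sum -rmorphB normc_real.
Qed.

Lemma inner_semi_inner : semi_inner (@inner R d).
Proof.
split=> [a f g h|a f g h|f].
- apply: (climit_uniq (inner_climit h _)).
  apply: climit_ext (climitD (climitM a (inner_climit h f)) (inner_climit h g)).
  move=> F; rewrite mulr_sumr -big_split; apply: eq_bigr => w _.
  by rewrite coefD coefZ /=; ring.
- apply: (climit_uniq (inner_climit _ h)).
  apply: climit_ext (climitD (climitM a^* (inner_climit f h)) (inner_climit g h)).
  move=> F; rewrite mulr_sumr -big_split; apply: eq_bigr => w _.
  by rewrite coefD coefZ rmorphD rmorphM /=; ring.
- rewrite inner_self ler0c fine_ge0 //; apply: esum_ge0 => w _.
  by rewrite lee_fin sqr_ge0.
Qed.

Lemma hnormE f : hnorm f = semi_norm (@inner R d) f.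
Proof. by rewrite /semi_norm inner_self. Qed.

Lemma hnorm_ge0 f : 0 <= hnorm f. Proof. exact: sqrtr_ge0. Qed.

Lemma sqr_hnorm f : hnorm f ^+ 2 = complex.Re (inner f f).
Proof. by rewrite hnormE (sqr_semi_norm inner_semi_inner). Qed.

Lemma hnormD f g : hnorm (f + g) <= hnorm f + hnorm g.
Proof. by rewrite !hnormE; exact: semi_normD inner_semi_inner _ _. Qed.

Lemma hnormZ a f : hnorm (a *: f) = normc a * hnorm f.
Proof. by rewrite !hnormE; exact: semi_normZ inner_semi_inner _ _. Qed.

Lemma hnorm0 : hnorm (0 : H) = 0.
Proof. by rewrite hnormE; exact: semi_norm0 inner_semi_inner. Qed.

Lemma inner_le f g : normc (inner f g) <= hnorm f * hnorm g.
Proof. by rewrite !hnormE; exact: cauchy_schwarz inner_semi_inner _ _. Qed.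

Lemma fset_sum_le_hnorm f F : \sum_(w <- F) normc (f w) ^+ 2 <= hnorm f ^+ 2.
Proof. by rewrite sqr_hnorm inner_self /= (sqsum_fset_le (hardy_sqsummable f)). Qed.

Lemma hnorm_le_fset f M : 0 <= M ->
  (forall F, \sum_(w <- F) normc (f w) ^+ 2 <= M ^+ 2) -> hnorm f <= M.
Proof.
move=> M0 fM; rewrite -ler_sqr ?nnegrE ?hnorm_ge0 // sqr_hnorm.
apply: (climit_Re_le (inner_climit f f)); apply: nearW => F.
rewrite Re_sum; apply: le_trans (fM F); apply: ler_sum => w _.
by rewrite mul_conjc.
Qed.

Lemma coef_le f w : normc (f w) <= hnorm f.
Proof.
apply: ler_sqr_normc; first exact: hnorm_ge0.
by have := fset_sum_le_hnorm f [fset w]%fset; rewrite big_seq_fset1.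
Qed.

Lemma monomialE v w : (monomial v : H) w = (w == v)%:R. Proof. by []. Qed.

Lemma inner_monomial v f : inner (monomial v) f = f v.
Proof.
apply: (climit_uniq (inner_climit _ f)) => e e0.
apply: (@near_totally [fset v]%fset) => F; rewrite fsub1set => vF.
rewrite (big_fsetD1 v) //= eqxx rmorph1 mul1r big_seq big1 ?addr0 ?subrr ?normc0 //.
move=> w; rewrite in_fsetD1 => /andP[/negbTE -> _].
by rewrite rmorph0 mul0r.
Qed.

Lemma coef_fsum F (c : word d -> C) v :
  (\sum_(w <- F) c w *: monomial w : H) v = if v \in F then c v else 0.
Proof.
rewrite coef_sum; case: ifPn => vF.
  rewrite (big_fsetD1 v) // coefZ monomialE eqxx mulr1 big_seq big1.
    by rewrite /= addr0.
  move=> w; by rewrite in_fsetD1 coefZ monomialE eq_sym => /andP[/negbTE -> _];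
    rewrite mulr0.
rewrite big_seq big1 // => w wF; rewrite coefZ monomialE.
by case: eqP => [vw|]; [rewrite vw wF in vF|rewrite mulr0].
Qed.

Definition truncate F f : H := \sum_(w <- F) f w *: monomial w.

Lemma truncateE F f w : truncate F f w = if w \in F then f w else 0.
Proof. exact: coef_fsum. Qed.

Lemma inner_truncate F f g : inner (truncate F f) g = \sum_(w <- F) (f w)^* * g w.
Proof.
rewrite (semi_inner_suml inner_semi_inner); apply: eq_bigr => w _.
by rewrite (semi_innerZl inner_semi_inner) inner_monomial.
Qed.

Lemma hnorm_sub_truncate F f :
  hnorm (f - truncate F f) ^+ 2 = hnorm f ^+ 2 - \sum_(w <- F) normc (f w) ^+ 2.
Proof.
rewrite !sqr_hnorm (ReD_semi_inner inner_semi_inner).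
rewrite !(semi_innerNr inner_semi_inner) !(semi_innerNl inner_semi_inner) opprK.
rewrite (semi_innerC inner_semi_inner (truncate F f) f) ReN ReJ !inner_truncate.
rewrite [X in _ + complex.Re X](_ : _ = \sum_(w <- F) (f w)^* * f w).
  rewrite !Re_sum (eq_bigr (fun w => normc (f w) ^+ 2)).
    by ring.
  by move=> w _; rewrite mul_conjc.
by rewrite big_seq [RHS]big_seq; apply: eq_bigr => w wF; rewrite truncateE wF.
Qed.

Lemma truncate_cvg f (e : R) : 0 < e ->
  \forall F \near totally, hnorm (f - truncate F f) < e.
Proof.
move=> e0; have e20 : 0 < e ^+ 2 by rewrite exprn_gt0.
have := inner_climit f f e20; apply: filterS => F.
rewrite -[in X in _ -> X]ltr_sqr ?nnegrE ?hnorm_ge0 ?ltW // inner_self.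
rewrite (eq_bigr (fun w => (normc (f w) ^+ 2)%:C)); last by move=> w _; exact: mul_conjc.
rewrite -rmorph_sum -rmorphB normc_real hnorm_sub_truncate sqr_hnorm inner_self /=.
by rewrite distrC; apply: le_lt_trans; exact: ler_norm.
Qed.

Lemma climit_cauchy (u : nat -> C) :
  (forall e : R, 0 < e -> exists N, forall m n, (N <= m)%N -> (N <= n)%N ->
    normc (u m - u n) < e) ->
  exists l, climit \oo u l.
Proof.
move=> uC.
have cvgr (p : C -> R) : (forall z t, p (z - t) = p z - p t) ->
    (forall z, `|p z| <= normc z) -> cvgn (fun n => p (u n)).
  move=> pB pn; apply/cauchy_cvgP/cauchy_exP => e e0.
  have [N uN] := uC _ e0; exists (p (u N)).
  exists N => // n Nn; rewrite /ball /= -pB.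
  exact: le_lt_trans (pn _) (uN _ _ (leqnn _) Nn).
have /cvgrPdist_lt rel := cvgr (@complex.Re R) (@ReB R) (@absRe_le_normc R).
have /cvgrPdist_lt iml : cvgn (fun n => complex.Im (u n)).
  by apply: cvgr (@absIm_le_normc R) => -[a b] [].
exists (limn (fun n => complex.Re (u n)) +i* limn (fun n => complex.Im (u n))).
move=> e e0; have e20 : 0 < e / 2 by rewrite divr_gt0.
near=> n; apply: le_lt_trans (normc_le_ReIm _) _; rewrite [ltRHS]splitr.
rewrite -normrN -[X in _ + X]normrN ltrD //.
  by rewrite ReB opprB; near: n; exact: rel.
case E : (u n) => [a b] /=; rewrite opprB (_ : b = complex.Im (u n)) ?E //.
by rewrite -E; near: n; exact: iml.
Unshelve. all: by end_near. Qed.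

Lemma hardy_complete (u : nat -> H) :
  (forall e : R, 0 < e -> exists N, forall m n, (N <= m)%N -> (N <= n)%N ->
    hnorm (u m - u n) < e) ->
  exists f, forall e : R, 0 < e -> exists N, forall n, (N <= n)%N ->
    hnorm (u n - f) <= e.
Proof.
move=> uC.
have /choice[c uc] w : exists l : C, climit \oo (fun n => u n w) l.
  apply: climit_cauchy => e /uC[N uN]; exists N => m n Nm Nn.
  exact: le_lt_trans (coef_le (u m - u n) w) (uN _ _ Nm Nn).
(* An estimate on finitely many coefficients survives [m] going to infinity, so the Cauchy bound
   holds with [u m] replaced by the coefficientwise limit [c]. *)
have close e N : 0 < e -> (forall m n, (N <= m)%N -> (N <= n)%N ->
    hnorm (u m - u n) < e) -> forall n F, (N <= n)%N ->
    \sum_(w <- F) normc (u n w - c w) ^+ 2 <= e ^+ 2.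
  move=> e0 uN n F Nn.
  have L : climit \oo
      (fun m => \sum_(w <- F) (u n w - u m w)^* * (u n w - u m w))
      (\sum_(w <- F) (u n w - c w)^* * (u n w - c w)).
    apply: climit_sum => w.
    have ucw : climit \oo (fun m => u n w - u m w) (u n w - c w).
      exact: climitB (climit_cst _) (uc w).
    exact: climit_mul (climit_conj ucw) ucw.
  rewrite (eq_bigr (fun w => complex.Re ((u n w - c w)^* * (u n w - c w)))); last first.
    by move=> w _; rewrite mul_conjc.
  rewrite -Re_sum; apply: (climit_Re_le L).
  exists N => // m Nm; rewrite Re_sum.
  apply: (@le_trans _ _ (hnorm (u n - u m) ^+ 2)); last first.
    by rewrite ler_sqr ?nnegrE ?hnorm_ge0 ?ltW // uN.
  apply: le_trans (fset_sum_le_hnorm _ F); apply: ler_sum => w _.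
  by rewrite mul_conjc coefB.
have [N uN] := uC 1 ltr01.
(* Square summability is available for [u N - c] rather than for [c], so the limit is assembled as
   [u N - (u N - c)]. *)
have cS : (fun w => u N w - c w) \in sqsummable.
  by apply: (@sqsum_le _ _ _ (1 ^+ 2)) => F; exact: close uN _ _ _.
exists (u N - Hardy cS) => e e0; have [N' uN'] := uC _ e0.
exists N' => n N'n; apply: hnorm_le_fset (ltW e0) _ => F.
rewrite (eq_bigr (fun w => normc (u n w - c w) ^+ 2)); first exact: close uN' _ _ _.
by move=> w _; rewrite !coefB (_ : Hardy cS w = u N w - c w) // subKr.
Qed.

End UnorderedSums.

(** * Bounded operators and adjoints *)

Section LinearMaps.
Context {R : pzRingType} {U W : lmodType R}.
Variable T : U -> W.
Hypothesis lT : linear T.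

Lemma linear_map0 : T 0 = 0.
Proof. by have := lT (-1) 0 0; rewrite scaler0 addr0 scaleN1r addNr. Qed.

Lemma linear_mapD x y : T (x + y) = T x + T y.
Proof. by have := lT 1 x y; rewrite !scale1r. Qed.

Lemma linear_mapZ a x : T (a *: x) = a *: T x.
Proof. by have := lT a x 0; rewrite linear_map0 !addr0. Qed.

Lemma linear_mapN x : T (- x) = - T x.
Proof. by rewrite -scaleN1r linear_mapZ scaleN1r. Qed.

Lemma linear_mapB x y : T (x - y) = T x - T y.
Proof. by rewrite linear_mapD linear_mapN. Qed.

Lemma linear_map_sum I (r : seq I) (F : I -> U) :
  T (\sum_(i <- r) F i) = \sum_(i <- r) T (F i).
Proof. exact: (big_morph T linear_mapD linear_map0). Qed.

End LinearMaps.

Section BoundedOperators.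
Context {R : realType} {d : nat}.
Local Notation C := R[i].
Local Notation H := (hardy R d).
Implicit Types (f g h : H) (T S : H -> H).

Lemma sumopE I (r : seq I) (T : I -> H -> H) f :
  (\sum_(i <- r) T i) f = \sum_(i <- r) T i f.
Proof. by rewrite fct_sumE. Qed.

Definition norm_bound T (M : R) : Prop := forall f, hnorm (T f) <= M * hnorm f.

Lemma bounded_opP T : bounded_op T -> exists2 M, 0 <= M & norm_bound T M.
Proof.
move=> [_ [M TM]]; exists (Num.max M 0); first by rewrite le_max lexx orbT.
move=> f; apply: le_trans (TM f) _; rewrite ler_wpM2r ?hnorm_ge0 //.
by rewrite le_max lexx.
Qed.

Lemma bounded_op0 : bounded_op (0 : H -> H).
Proof.
split=> [a f g|]; first by rewrite scaler0 addr0.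
by exists 0 => f; rewrite hnorm0 mul0r.
Qed.

Lemma bounded_opD T S : bounded_op T -> bounded_op S -> bounded_op (T + S).
Proof.
move=> [lT [M TM]] [lS [N SN]]; split.
  by move=> a f g; rewrite !fctE lT lS scalerDr addrACA.
exists (M + N) => f; rewrite mulrDl; apply: le_trans (hnormD _ _) _.
exact: lerD.
Qed.

Lemma bounded_opZ a T : bounded_op T -> bounded_op (a *: T).
Proof.
move=> [lT [M TM]]; split.
  by move=> b f g; rewrite !fctE lT scalerDr !scalerA mulrC.
by exists (normc a * M) => f; rewrite hnormZ -mulrA ler_wpM2l ?normc_ge0.
Qed.

Lemma bounded_opN T : bounded_op T -> bounded_op (- T).
Proof. by rewrite -scaleN1r; exact: bounded_opZ. Qed.

Lemma bounded_opB T S : bounded_op T -> bounded_op S -> bounded_op (T - S).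
Proof. by move=> bT /bounded_opN; exact: bounded_opD. Qed.

Lemma bounded_op_sum I (r : seq I) (T : I -> H -> H) :
  (forall i, bounded_op (T i)) -> bounded_op (\sum_(i <- r) T i).
Proof.
move=> bT; apply: big_ind => //; [exact: bounded_op0|exact: bounded_opD].
Qed.

Lemma bounded_op_id : bounded_op (idfun : H -> H).
Proof. by split=> //; exists 1 => f; rewrite mul1r. Qed.

Lemma bounded_op_comp T S : bounded_op T -> bounded_op S -> bounded_op (T \o S).
Proof.
move=> bT [lS [N SN]]; have [M M0 TM] := bounded_opP bT; split.
  by move=> a f g /=; rewrite lS bT.1.
exists (M * N) => f /=; apply: le_trans (TM _) _.
by rewrite -mulrA ler_wpM2l.
Qed.

Lemma opnorm_bound T : bounded_op T -> norm_bound T (opnorm T).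
Proof.
move=> bT f; have [M M0 TM] := bounded_opP bT.
set X := [set hnorm (T f) | f in [set f | hnorm f <= 1]].
have ubX : has_ubound X.
  exists M => _ [g /= g1 <-]; apply: le_trans (TM g) _.
  by rewrite -[leRHS]mulr1 ler_wpM2l.
have := hnorm_ge0 f; rewrite le0r => /orP[/eqP f0|f0].
  by apply: le_trans (TM f) _; rewrite f0 !mulr0.
have i0 : 0 <= (hnorm f)^-1 by rewrite invr_ge0 ltW.
rewrite -ler_pdivrMr //.
have -> : hnorm (T f) / hnorm f = hnorm (T ((hnorm f)^-1%:C *: f)).
  rewrite (linear_mapZ bT.1) hnormZ normc_real ger0_norm //.
  by rewrite mulrC.
apply: ub_le_sup => //; exists ((hnorm f)^-1%:C *: f) => //=.
by rewrite hnormZ normc_real ger0_norm // mulVf ?gt_eqF.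
Qed.

Lemma opnorm_le T M : 0 <= M -> norm_bound T M -> opnorm T <= M.
Proof.
move=> M0 TM; apply: ge_sup.
  by exists (hnorm (T 0)); exists 0 => //=; rewrite hnorm0.
move=> _ [f /= f1 <-]; apply: le_trans (TM f) _.
by rewrite -[leRHS]mulr1 ler_wpM2l.
Qed.

(** Truncations are finite combinations of monomials, so [p] kills them, and they approximate [f].
    The sign of [M] is unknown, hence the divisor [Num.max M 0 + 1]. *)
Lemma functional_eq0 (p : H -> C) (M : R) : scalar p ->
  (forall f, normc (p f) <= M * hnorm f) ->
  (forall v, p (monomial v) = 0) -> forall f, p f = 0.
Proof.
move=> lp pM p0 f; apply/eq0_normc/le_anti; rewrite normc_ge0 andbT.
apply/ler_addgt0Pr => e e0; rewrite add0r.
have M1 : 0 < Num.max M 0 + 1 by rewrite ltr_wpDl // le_max lexx orbT.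
have eM : 0 < e / (Num.max M 0 + 1) by rewrite divr_gt0.
have [F fF] := filter_ex (truncate_cvg f eM).
have -> : p f = p (f - truncate F f).
  rewrite (linear_mapB (W := C^o) lp) (linear_map_sum (W := C^o) lp) big1 ?subr0 //.
  by move=> w _; rewrite (linear_mapZ (W := C^o) lp) p0 scaler0.
apply: le_trans (pM _) _; apply: (@le_trans _ _ ((Num.max M 0 + 1) * hnorm (f - truncate F f))).
  by rewrite ler_wpM2r ?hnorm_ge0 // ler_wpDr // le_max lexx.
by rewrite mulrC -ler_pdivlMr // ltW.
Qed.

Lemma bounded_op_ext T S : bounded_op T -> bounded_op S ->
  (forall v, T (monomial v) = S (monomial v)) -> T = S.
Proof.
move=> bT bS TS; apply/funext => f; apply: hardyP => w.
have bTS := bounded_opB bT bS; have [M M0 TSM] := bounded_opP bTS.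
apply/eqP; rewrite -subr_eq0 -coefB; apply/eqP.
apply: (@functional_eq0 (fun f => (T - S) f w) M) => [a g h|g|v].
- by rewrite bTS.1 coefD coefZ.
- exact: le_trans (coef_le _ _) (TSM _).
- by rewrite !fctE TS subrr coef0.
Qed.

Lemma inner_eq0 f : (forall g, inner g f = 0) -> f = 0.
Proof. by move=> f0; apply: hardyP => w; rewrite -inner_monomial f0. Qed.

Lemma inner_inj f f' : (forall g, inner g f = inner g f') -> f = f'.
Proof.
move=> ff'; apply/eqP; rewrite -subr_eq0; apply/eqP/inner_eq0 => g.
by rewrite (semi_innerBr inner_semi_inner) ff' subrr.
Qed.

(** Test with [f = T g] and cancel one factor [hnorm (T g)]. When [T g = 0] and [M] is negative, the
    hypothesis at [f = g] forces [hnorm g = 0]. *)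
Lemma norm_bound_inner T (M : R) :
  (forall f g, normc (inner f (T g)) <= M * hnorm f * hnorm g) -> norm_bound T M.
Proof.
move=> TM g; have := TM (T g) g; have := hnorm_ge0 (T g).
rewrite le0r => /orP[/eqP Tg0 _|Tg0].
  have [M0|M0] := leP 0 M; first by rewrite Tg0 mulr_ge0 ?hnorm_ge0.
  have := TM g g; have := hnorm_ge0 g; rewrite le0r => /orP[/eqP ->|g0].
    by move=> _; rewrite mulr0 Tg0.
  move=> /(le_trans (normc_ge0 _)).
  by rewrite -mulrA leNgt nmulr_rlt0 ?mulr_gt0.
rewrite inner_self normc_real -[fine _]/(complex.Re (fine _)%:C) -inner_self.
rewrite -sqr_hnorm ger0_norm ?sqr_ge0 // expr2 -mulrA mulrCA ler_pM2l //.
Qed.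

(** The adjoint is given by its coefficients [inner (T (monomial v)) g]. They are square summable by
    testing [T] on the finite series built from these same coefficients; the adjoint identity then
    spreads from monomials by [functional_eq0]. *)
Lemma adjoint_exists T : bounded_op T ->
  exists S, bounded_op S /\ is_adjoint T S.
Proof.
move=> bT; have [M M0 TM] := bounded_opP bT.
pose c g : word d -> C := fun v => inner (T (monomial v)) g.
have cS g (F : {fset word d}) : \sum_(w <- F) normc (c g w) ^+ 2 <= (M * hnorm g) ^+ 2.
  pose x : H := \sum_(w <- F) c g w *: monomial w.
  have Tx : inner (T x) g = (\sum_(w <- F) normc (c g w) ^+ 2)%:C.
    rewrite (linear_map_sum bT.1) (semi_inner_suml inner_semi_inner) rmorph_sum.
    apply: eq_bigr => w _; rewrite (linear_mapZ bT.1).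
    by rewrite (semi_innerZl inner_semi_inner) mul_conjc.
  have x2 : hnorm x ^+ 2 = \sum_(w <- F) normc (c g w) ^+ 2.
    rewrite sqr_hnorm (semi_inner_suml inner_semi_inner) Re_sum big_seq [RHS]big_seq.
    apply: eq_bigr => w wF.
    by rewrite (semi_innerZl inner_semi_inner) inner_monomial /x coef_fsum wF mul_conjc.
  have := inner_le (T x) g; rewrite Tx -x2 normc_real ger0_norm ?sqr_ge0 //.
  have := hnorm_ge0 x; rewrite le0r => /orP[/eqP ->|x0].
    by rewrite expr0n sqr_ge0.
  move=> /le_trans /(_ (ler_wpM2r (hnorm_ge0 g) (TM x))).
  rewrite -mulrA mulrCA expr2 ler_pM2l // => xM.
  by rewrite -expr2 ler_sqr ?nnegrE ?mulr_ge0 ?hnorm_ge0.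
pose S g := Hardy (sqsum_le (cS g)).
have lS : linear S.
  move=> a f g; apply: hardyP => w; rewrite coefD coefZ /= /c.
  by rewrite (semi_innerPr inner_semi_inner).
exists S; split.
  split=> //; exists M => g.
  by apply: hnorm_le_fset => [|F]; [rewrite mulr_ge0 ?hnorm_ge0|exact: cS].
move=> f g; apply/eqP; rewrite -subr_eq0 -conjC_eq0 rmorphB /= -!(semi_innerC inner_semi_inner).
apply/eqP; pose p f := inner g (T f) - inner (S g) f.
apply: (@functional_eq0 p (hnorm g * M + hnorm (S g))) => {f} [a f h|f|v].
- by rewrite /p bT.1 !(semi_innerPr inner_semi_inner) /GRing.scale /=; ring.
- apply: le_trans (normcB_le _ _) _; rewrite mulrDl lerD ?inner_le // -mulrA.
  by apply: le_trans (inner_le _ _) _; rewrite ler_wpM2l ?hnorm_ge0.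
- rewrite /p (semi_innerC inner_semi_inner (monomial v) (S g)) inner_monomial.
  by rewrite /= /c -(semi_innerC inner_semi_inner) subrr.
Qed.

Lemma adj_spec T : bounded_op T -> bounded_op (adj T) /\ is_adjoint T (adj T).
Proof.
move=> /adjoint_exists TS.
exact: (xgetPex 0 (P := [set S | bounded_op S /\ is_adjoint T S])).
Qed.

Lemma bounded_adj T : bounded_op T -> bounded_op (adj T).
Proof. by move=> /adj_spec[]. Qed.

Lemma inner_adjr T f g : bounded_op T -> inner f (adj T g) = inner (T f) g.
Proof. by move=> /adj_spec[_ ->]. Qed.

Lemma adj_unique T S : bounded_op T -> is_adjoint T S -> adj T = S.
Proof.
move=> bT TS; apply/funext => g; apply: inner_inj => f.
by rewrite inner_adjr // TS.
Qed.

Lemma adjP a T S : bounded_op T -> bounded_op S ->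
  adj (a *: T + S) = a^* *: adj T + adj S.
Proof.
move=> bT bS; apply: adj_unique; first exact: bounded_opD (bounded_opZ _ bT) bS.
move=> f g; rewrite !fctE (semi_innerPl inner_semi_inner).
by rewrite (semi_innerPr inner_semi_inner) !inner_adjr.
Qed.

Lemma adj0 : adj (0 : H -> H) = 0.
Proof.
apply: adj_unique; first exact: bounded_op0.
by move=> f g; rewrite (semi_inner0r inner_semi_inner) (semi_inner0l inner_semi_inner).
Qed.

Lemma adj_comp T S : bounded_op T -> bounded_op S ->
  adj (T \o S) = adj S \o adj T.
Proof.
move=> bT bS; apply: adj_unique; first exact: bounded_op_comp.
by move=> f g /=; rewrite !inner_adjr.
Qed.

Lemma adj_id : adj (idfun : H -> H) = idfun.
Proof. by apply: adj_unique => //; exact: bounded_op_id. Qed.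

Lemma norm_bound_adj T M : bounded_op T -> norm_bound T M -> norm_bound (adj T) M.
Proof.
move=> bT TM; apply: norm_bound_inner => f g; rewrite inner_adjr //.
apply: le_trans (inner_le _ _) _; by rewrite ler_wpM2r ?hnorm_ge0.
Qed.

Lemma shift_linear j : linear (@shift R d j).
Proof.
move=> a f g; apply: hardyP => -[|k v]; rewrite coefD coefZ /=.
  by rewrite mulr0 addr0.
by case: eqP => _; rewrite ?mulr0 ?addr0.
Qed.

Lemma seq_sum_le_hnorm f (s : seq (word d)) : uniq s ->
  \sum_(w <- s) normc (f w) ^+ 2 <= hnorm f ^+ 2.
Proof.
move=> us; apply: le_trans (fset_sum_le_hnorm f [fset w in s]%fset).
rewrite (perm_big (enum_fset [fset w in s]%fset)) //.
apply: uniq_perm => // w; by rewrite inE.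
Qed.

Lemma shift_nil j f : shift j f [::] = 0. Proof. by []. Qed.

Lemma shift_cons j f k v : shift j f (k :: v) = if k == j then f v else 0.
Proof. by []. Qed.

(** A word starting with [j] is determined by its tail, so the nonzero coefficients of [shift j f]
    at distinct words are coefficients of [f] at distinct words. *)
Lemma shift_norm j : norm_bound (@shift R d j) 1.
Proof.
move=> f; rewrite mul1r; apply: hnorm_le_fset => [|F]; first exact: hnorm_ge0.
pose P (w : word d) := ohead w == Some j.
have out w : ~~ P w -> normc (shift j f w) ^+ 2 = 0.
  case: w => [|k v]; first by rewrite shift_nil normc0 expr0n.
  rewrite shift_cons /P [ohead _]/= (inj_eq Some_inj) => /negbTE ->; by rewrite normc0 expr0n.
rewrite (bigID P) /= [X in _ + X]big1 // addr0.
rewrite -big_filter (eq_big_seq (fun w => normc (f (behead w)) ^+ 2)); last first.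
  move=> [|k v]; rewrite mem_filter /P //= (inj_eq Some_inj).
  by case: eqP.
rewrite -(big_map behead xpredT (fun w => normc (f w) ^+ 2)).
apply: seq_sum_le_hnorm; rewrite map_inj_in_uniq ?filter_uniq ?fset_uniq //.
move=> [|k v] [|k' v']; rewrite !mem_filter /P //=.
by move=> /andP[/eqP[->] _] /andP[/eqP[->] _] ->.
Qed.

Lemma bounded_shift j : bounded_op (@shift R d j).
Proof. by split; [exact: shift_linear|exists 1; exact: shift_norm]. Qed.

Lemma bounded_shiftw s : bounded_op (@shiftw R d s).
Proof.
elim: s => [|j s IH]; first exact: bounded_op_id.
exact: bounded_op_comp (bounded_shift j) IH.
Qed.

Lemma shift_monomial j v : shift j (monomial v : H) = monomial (j :: v).
Proof.
apply: hardyP => -[|k w] //=; rewrite /monomial /=.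
by rewrite eqseq_cons; case: eqP.
Qed.

Lemma shiftw_monomial s v : shiftw s (monomial v : H) = monomial (s ++ v).
Proof. by elim: s => //= j s ->; rewrite shift_monomial. Qed.

Lemma adj_shift_comp j k :
  adj (@shift R d j) \o shift k = if j == k then idfun else 0.
Proof.
have bj := bounded_shift j; apply: bounded_op_ext.
- exact: bounded_op_comp (bounded_adj bj) (bounded_shift k).
- by case: eqP => _; [exact: bounded_op_id|exact: bounded_op0].
move=> v; apply: inner_inj => g /=; rewrite inner_adjr // shift_monomial.
rewrite (semi_innerC inner_semi_inner (monomial _)) inner_monomial /=.
rewrite [k == j]eq_sym; case: eqP => _ /=.
  by rewrite (semi_innerC inner_semi_inner (monomial _)) inner_monomial.
by rewrite rmorph0 (semi_inner0r inner_semi_inner).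
Qed.

Lemma shiftw_cat s t : @shiftw R d (s ++ t) = shiftw s \o shiftw t.
Proof. by elim: s => //= j s ->. Qed.

End BoundedOperators.

(** * The wandering vector of a row isometry *)

Section WanderingVector.
Context {R : realType} {d : nat} {V : lmodType R[i]}.
Local Notation C := R[i].
Local Notation H := (hardy R d).
(** In the application [V] consists of the polynomial operators, [phi] is the GNS form, [S j] is
    left multiplication by [L_j], [c] reads the constant coefficient, [lam] is the Christoffel
    number at zero and [w] a minimizing sequence for it. *)
Variables (phi : V -> V -> C) (S : 'I_d -> V -> V) (c : V -> C).
Variables (lam : R) (w : nat -> V).
Hypothesis phiP : semi_inner phi.
Hypothesis lS : forall j, linear (S j).
Hypothesis phiS : forall j k x y, phi (S j x) (S k y) = if j == k then phi x y else 0.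
Hypothesis lc : scalar c.
Hypothesis cS : forall j x, c (S j x) = 0.
Hypothesis lam0 : 0 < lam.
Hypothesis lam_le : forall x, lam * normc (c x) ^+ 2 <= complex.Re (phi x x).
Hypothesis cw : forall k, c (w k) = 1.
Hypothesis w_min : forall e : R, 0 < e ->
  \forall k \near \oo, complex.Re (phi (w k) (w k)) < lam + e.

Local Notation N := (semi_norm phi).

(* Subtracting the minimum keeps the form positive, and the minimizing sequence
   [w] is null for the difference: this is why it converges. *)
Definition defect x y : C := phi x y - lam%:C * ((c x)^* * c y).

Lemma defect_semi_inner : semi_inner defect.
Proof.
split=> [a x y z|a x y z|x]; rewrite /defect.
- by rewrite (semi_innerPr phiP) lc /GRing.scale /=; ring.
- by rewrite (semi_innerPl phiP) lc rmorphD rmorphM /=; ring.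
rewrite mul_conjc (semi_inner_realE phiP) -rmorphM -rmorphB ler0c subr_ge0.
exact: lam_le.
Qed.

Local Notation N' := (semi_norm defect).

Lemma defect_norm_le x : N' x <= N x.
Proof.
rewrite ler_sqrt ?(semi_inner_Re_ge0 phiP) // /defect mul_conjc ReB Re_mulC.
by rewrite gerBl; apply: mulr_ge0; [exact: ltW|exact: sqr_ge0].
Qed.

(** This carries smallness for [defect] over to [phi]: differences [w m - w n] and the ranges of the
    [S j] lie in the kernel of [c]. *)
Lemma defect_eq_phi x y : c y = 0 -> defect x y = phi x y.
Proof. by rewrite /defect => ->; rewrite !mulr0 subr0. Qed.

Lemma defect_norm_w (e : R) : 0 < e -> \forall k \near \oo, N' (w k) < e.
Proof.
move=> e0; have e20 : 0 < e ^+ 2 by rewrite exprn_gt0.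
apply: filterS (w_min e20) => k wk.
rewrite -ltr_sqr ?nnegrE ?semi_norm_ge0 ?ltW // (sqr_semi_norm defect_semi_inner).
by rewrite /defect cw rmorph1 !mulr1 ReB ltrBlDl.
Qed.

(** Since [c (w k) = 1], the error is exactly [defect (w k) y], and [w k] is null for [defect]. In
    the limit, [w] represents the functional [lam * c]. *)
Lemma climit_phi_w y : climit \oo (fun k => phi (w k) y) (lam%:C * c y).
Proof.
move=> e e0; have N1 : 0 < N' y + 1 by rewrite ltr_wpDl ?semi_norm_ge0.
have eN : 0 < e / (N' y + 1) by rewrite divr_gt0.
apply: filterS (defect_norm_w eN) => k wk.
have -> : phi (w k) y - lam%:C * c y = defect (w k) y.
  by rewrite /defect cw rmorph1 mul1r.
apply: le_lt_trans (cauchy_schwarz defect_semi_inner _ _) _.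
apply: (@le_lt_trans _ _ (N' (w k) * (N' y + 1))).
  by rewrite ler_wpM2l ?semi_norm_ge0 // lerDl.
by rewrite -ltr_pdivlMr.
Qed.

Definition wordop (s : word d) : V -> V := foldr (fun j T => S j \o T) idfun s.

Lemma wordop_linear s : linear (wordop s).
Proof. by elim: s => [//|j s IH] a x y /=; rewrite IH lS. Qed.

Lemma wordop_cat s t x : wordop (s ++ t) x = wordop s (wordop t x).
Proof. by elim: s => //= j s ->. Qed.

Lemma phi_wordop s x y : phi (wordop s x) (wordop s y) = phi x y.
Proof. by elim: s => //= j s IH; rewrite phiS eqxx. Qed.

(* The limit of [w] is a wandering vector of the row isometry [S]; [ell s x] is the
   inner product of its [s]-translate with [x]. *)
Definition ell (s : word d) (x : V) : C :=
  xget 0 [set l | climit \oo (fun k => phi (wordop s (w k)) x) l].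

(** The sequence is Cauchy because [wordop s] is isometric for [phi], and on [w m - w n] the
    [phi]-norm is the [defect]-norm. *)
Lemma climit_ell s x : climit \oo (fun k => phi (wordop s (w k)) x) (ell s x).
Proof.
suff [l hl] : exists l, climit \oo (fun k => phi (wordop s (w k)) x) l.
  exact: (xgetPex 0 (P := [set l | climit \oo (fun k => phi (wordop s (w k)) x) l])
    (ex_intro _ l hl)).
apply: climit_cauchy => e e0.
have N1 : 0 < N x + 1 by rewrite ltr_wpDl ?semi_norm_ge0.
have eN : 0 < e / (N x + 1) / 2 by rewrite !divr_gt0.
have [n0 _ wn0] := defect_norm_w eN; exists n0 => m n m0 n00.
rewrite -(semi_innerBl phiP) -(linear_mapB (wordop_linear s)).
apply: le_lt_trans (cauchy_schwarz phiP _ _) _.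
have -> : N (wordop s (w m - w n)) = N' (w m - w n).
  rewrite /semi_norm phi_wordop defect_eq_phi // (linear_mapB (W := C^o) lc).
  by rewrite !cw subrr.
apply: (@le_lt_trans _ _ (N' (w m - w n) * (N x + 1))).
  by rewrite ler_wpM2l ?semi_norm_ge0 // lerDl.
rewrite -ltr_pdivlMr //; apply: le_lt_trans (semi_normB defect_semi_inner _ _) _.
by rewrite [ltRHS]splitr ltrD // wn0.
Qed.

Lemma ell_linear s a x y : ell s (a *: x + y) = a * ell s x + ell s y.
Proof.
apply: (climit_uniq (climit_ell _ _)).
apply: climit_ext (climitD (climitM a (climit_ell s x)) (climit_ell s y)) => k.
by rewrite (semi_innerPr phiP).
Qed.

Lemma ell_nil x : ell [::] x = lam%:C * c x.
Proof. by apply: (climit_uniq (climit_ell _ _)); exact: climit_phi_w. Qed.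

Lemma ell_cons j s k x : ell (j :: s) (S k x) = if j == k then ell s x else 0.
Proof.
apply: (climit_uniq (climit_ell _ _)) => /=.
case: eqP => [<-|/eqP/negbTE jk].
  by apply: climit_ext (climit_ell s x) => n; rewrite phiS eqxx.
by apply: climit_ext (climit_cst 0) => n; rewrite phiS jk.
Qed.

(** Equal first letters cancel and distinct ones give 0, leaving [w k] paired with itself or with a
    vector in the range of some [S j]. Both arguments move with [k], as they do in the pairings of
    two lifts below. *)
Lemma climit_phi_ww s t :
  climit \oo (fun k => phi (wordop s (w k)) (wordop t (w k)))
    (if s == t then lam%:C else 0).
Proof.
(* On the range of [S j], [phi] may be replaced by [defect], for which [w k] is null; the other
   factor is eventually at most [Num.sqrt (lam + 1)], by [w_min] with [e = 1]. *)
have nil_cons j t' : climit \oo (fun k => phi (w k) (S j (wordop t' (w k)))) 0.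
  move=> e e0; have r0 : 0 < Num.sqrt (lam + 1) by rewrite sqrtr_gt0 addr_gt0.
  have er : 0 < e / Num.sqrt (lam + 1) by rewrite divr_gt0.
  near=> k; rewrite subr0 -defect_eq_phi //.
  apply: le_lt_trans (cauchy_schwarz defect_semi_inner _ _) _.
  apply: (@le_lt_trans _ _ (N' (w k) * Num.sqrt (lam + 1))); last first.
    by rewrite -ltr_pdivlMr //; near: k; exact: defect_norm_w.
  rewrite ler_wpM2l ?semi_norm_ge0 //.
  apply: le_trans (defect_norm_le _) _.
  rewrite /semi_norm phiS eqxx phi_wordop ler_wsqrtr // ltW //.
  by near: k; exact: w_min.
elim: s t => [|j s IH] [|k t] /=.
- move=> e e0; apply: filterS (w_min e0) => k wk.
  rewrite (semi_inner_realE phiP) -rmorphB normc_real.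
  have := lam_le (w k); rewrite cw normc1 expr1n mulr1 => lk.
  by rewrite ger0_norm ?subr_ge0 // ltrBlDl.
- exact: nil_cons.
- have := climit_conj (FF := eventually_filter) (nil_cons j s); rewrite rmorph0.
  by move=> L; apply: climit_ext L => n; rewrite -(semi_innerC phiP).
- rewrite eqseq_cons; case: eqP => [->|/eqP/negbTE jk] /=.
    by apply: climit_ext (IH t) => n; rewrite phiS eqxx.
  by apply: climit_ext (climit_cst 0) => n; rewrite phiS jk.
Unshelve. all: by end_near. Qed.

Implicit Types (r l : seq (C * word d)).

(** One list of coefficient-word pairs stands for a finite power series, [ser r], and for its
    counterpart in [V], [lift r k], where the monomial of [s] becomes the normalized translate of
    [w k] by [s]. Words may repeat, so that multiplication by a polynomial is the plain list
    operation [app]. *)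
Definition ser r : H := \sum_(p <- r) p.1 *: monomial p.2.
Definition lift r k : V :=
  \sum_(p <- r) (p.1 / (Num.sqrt lam)%:C) *: wordop p.2 (w k).
Definition polyV l (x : V) : V := \sum_(t <- l) t.1 *: wordop t.2 x.
Definition polyH l (f : H) : H := \sum_(t <- l) t.1 *: shiftw t.2 f.
Definition app l r := [seq (t.1 * p.1, t.2 ++ p.2) | t <- l, p <- r].

Lemma polyV_lift l r k : polyV l (lift r k) = lift (app l r) k.
Proof.
rewrite /lift big_allpairs_dep; apply: eq_bigr => t _.
rewrite (linear_map_sum (wordop_linear _)) scaler_sumr; apply: eq_bigr => p _ /=.
by rewrite (linear_mapZ (wordop_linear _)) scalerA mulrA wordop_cat.
Qed.

Lemma polyH_ser l r : polyH l (ser r) = ser (app l r).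
Proof.
rewrite /ser big_allpairs_dep; apply: eq_bigr => t _.
have lt := (@bounded_shiftw R d t.2).1.
rewrite (linear_map_sum lt) scaler_sumr; apply: eq_bigr => p _ /=.
by rewrite (linear_mapZ lt) scalerA shiftw_monomial.
Qed.

Lemma sqrt_lam_neq0 : (Num.sqrt lam)%:C != 0 :> C.
Proof. by rewrite eq_complex /= eqxx andbT sqrtr_eq0 -ltNge lam0. Qed.

(** The translates of the limit vector are orthogonal of norm [Num.sqrt lam], so these are Fourier
    coefficients in an orthonormal family. *)
Definition ucoef x s : C := ell s x / (Num.sqrt lam)%:C.

Lemma climit_lift r y : climit \oo (fun k => phi (lift r k) y)
  (\sum_(p <- r) p.1^* * ucoef y p.2).
Proof.
have L (p : C * word d) : climit \oo
    (fun k => phi ((p.1 / (Num.sqrt lam)%:C) *: wordop p.2 (w k)) y)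
    (p.1^* * ucoef y p.2).
  rewrite (_ : p.1^* * ucoef y p.2 = p.1^* / (Num.sqrt lam)%:C * ell p.2 y); last first.
    by rewrite /ucoef mulrCA mulrC.
  apply: climit_ext (climitM (p.1^* / (Num.sqrt lam)%:C) (climit_ell p.2 y)) => k.
  by rewrite (semi_innerZl phiP) rmorphM fmorphV /= conj_real.
apply: climit_ext (climit_sum r L) => k.
by rewrite (semi_inner_suml phiP).
Qed.

(** The divisions by [Num.sqrt lam] offset the [lam] of [climit_phi_ww]: in the limit, [lift] is
    isometric. *)
Lemma climit_lift2 r r' :
  climit \oo (fun k => phi (lift r k) (lift r' k)) (inner (ser r) (ser r')).
Proof.
have L (p q : C * word d) : climit \oo
    (fun k => phi ((p.1 / (Num.sqrt lam)%:C) *: wordop p.2 (w k))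
      ((q.1 / (Num.sqrt lam)%:C) *: wordop q.2 (w k)))
    (inner (p.1 *: monomial p.2) (q.1 *: monomial q.2 : H)).
  rewrite (semi_innerZl inner_semi_inner) (semi_innerZr inner_semi_inner).
  rewrite inner_monomial monomialE.
  have -> : p.1^* * (q.1 * (p.2 == q.2)%:R) = (p.1^* / (Num.sqrt lam)%:C) *
     (q.1 / (Num.sqrt lam)%:C) * (if p.2 == q.2 then lam%:C else 0).
    case: eqP => _; last by rewrite !mulr0.
    rewrite -[in lam%:C](sqr_sqrtr (ltW lam0)) rmorphXn /=.
    by field; exact: sqrt_lam_neq0.
  apply: climit_ext (climitM _ (climit_phi_ww p.2 q.2)) => k.
  rewrite (semi_innerZl phiP) (semi_innerZr phiP) rmorphM fmorphV /= conj_real.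
  by rewrite -[LHS]mulrA.
rewrite (semi_inner_suml inner_semi_inner).
under eq_bigr do rewrite (semi_inner_sumr inner_semi_inner).
apply: climit_ext (climit_sum r (fun p => climit_sum r' (L p))) => k.
rewrite (semi_inner_suml phiP); apply: eq_bigr => p _.
by rewrite (semi_inner_sumr phiP).
Qed.

(** Bessel's inequality: let [k] grow in the square of [x - lift r k], where [r] lists the Fourier
    coefficients of [x] on [F]. The cross terms and the square of the lift all tend to the same
    sum. *)
Lemma bessel x (F : {fset word d}) :
  \sum_(s <- F) normc (ucoef x s) ^+ 2 <= complex.Re (phi x x).
Proof.
pose r := [seq (ucoef x s, s) | s <- F].
have sums : \sum_(p <- r) p.1^* * ucoef x p.2 =
    (\sum_(s <- F) normc (ucoef x s) ^+ 2)%:C.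
  by rewrite big_map rmorph_sum; apply: eq_bigr => s _; rewrite mul_conjc.
have ser2 : inner (ser r) (ser r) = (\sum_(s <- F) normc (ucoef x s) ^+ 2)%:C.
  rewrite /ser big_map (semi_inner_suml inner_semi_inner) rmorph_sum big_seq [RHS]big_seq.
  apply: eq_bigr => s sF.
  by rewrite (semi_innerZl inner_semi_inner) inner_monomial coef_fsum sF mul_conjc.
have lr := climit_lift r x; rewrite sums in lr.
have lrr := climit_lift2 r r; rewrite ser2 in lrr.
have L : climit \oo (fun k => phi (x - lift r k) (x - lift r k))
  (phi x x - (\sum_(s <- F) normc (ucoef x s) ^+ 2)%:C).
  pose proof (climitD (climitB (climit_cst (phi x x))
    (climitD lr (climit_conj lr))) lrr) as L.
  move: L; rewrite conj_real opprD addrA subrK.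
  move=> L; apply: climit_ext L => k.
  rewrite !(semi_innerBl phiP) !(semi_innerBr phiP) -(semi_innerC phiP); ring.
rewrite -subr_ge0 -[\sum_(s <- F) _]/(complex.Re (\sum_(s <- F) _)%:C) -ReB.
apply: (climit_Re_ge0 L); apply: nearW => k; exact: semi_inner_Re_ge0.
Qed.

Definition wold_map x : H := Hardy (sqsum_le (bessel x)).

Lemma wold_mapE x s : wold_map x s = ell s x / (Num.sqrt lam)%:C.
Proof. by []. Qed.

Lemma wold_map_linear : linear wold_map.
Proof.
move=> a x y; apply: hardyP => s; rewrite coefD coefZ !wold_mapE ell_linear.
by rewrite mulrDl mulrA.
Qed.

(** This coefficient retains the extremal value: at a vector with [c x = 1] it is [Num.sqrt lam],
    which later bounds a Christoffel number from below. *)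
Lemma wold_map_nil x : wold_map x [::] = (Num.sqrt lam)%:C * c x.
Proof.
rewrite wold_mapE ell_nil -[in lam%:C](sqr_sqrtr (ltW lam0)) rmorphXn /=.
by field; exact: sqrt_lam_neq0.
Qed.

Lemma wold_mapS j x : wold_map (S j x) = shift j (wold_map x).
Proof.
apply: hardyP => -[|k s]; rewrite wold_mapE.
  by rewrite ell_nil cS mulr0 mul0r.
by rewrite ell_cons shift_cons; case: eqP; rewrite ?mul0r.
Qed.

Lemma wold_map_polyV l x : wold_map (polyV l x) = polyH l (wold_map x).
Proof.
rewrite /polyV (linear_map_sum wold_map_linear); apply: eq_bigr => t _.
rewrite (linear_mapZ wold_map_linear); congr (_ *: _).
by elim: t.2 => //= j s <-; rewrite wold_mapS.
Qed.

Lemma climit_lift_inner r y :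
  climit \oo (fun k => phi (lift r k) y) (inner (ser r) (wold_map y)).
Proof.
rewrite (_ : inner _ _ = \sum_(p <- r) p.1^* * ucoef y p.2); first exact: climit_lift.
rewrite (semi_inner_suml inner_semi_inner); apply: eq_bigr => p _.
by rewrite (semi_innerZl inner_semi_inner) inner_monomial.
Qed.

(** The hypothesis on [l] is applied to [x - lift r k], a stand-in for the part of [x] off the Wold
    subspace. As [k] grows, the real part tends to the difference of the two forms plus the form at
    [y - ser r], the price of a finite [r]. *)
Lemma wold_accretive_fin l x r y : y = wold_map x ->
  (forall a, 0 <= complex.Re (phi a (polyV l a))) ->
  complex.Re (inner y (polyH l y)) <= complex.Re (phi x (polyV l x)) +
    complex.Re (inner (y - ser r) (polyH l (y - ser r))).
Proof.
move=> yx l0.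
have lV : linear (polyV l).
  move=> a u v; rewrite scaler_sumr -big_split; apply: eq_bigr => t _ /=.
  by rewrite wordop_linear scalerDr !scalerA mulrC.
have lH : linear (polyH l).
  move=> a u v; rewrite scaler_sumr -big_split; apply: eq_bigr => t _ /=.
  by rewrite (bounded_shiftw _).1 scalerDr !scalerA mulrC.
have L : climit \oo (fun k => phi (x - lift r k) (polyV l (x - lift r k)))
  (phi x (polyV l x) - inner (ser r) (polyH l y) - (inner (polyH l (ser r)) y)^* +
   inner (ser r) (polyH l (ser r))).
  rewrite yx -wold_map_polyV polyH_ser.
  pose proof (climitD (climitB (climitB (climit_cst (phi x (polyV l x)))
    (climit_lift_inner r (polyV l x)))
    (climit_conj (climit_lift_inner (app l r) x))) (climit_lift2 r (app l r))) as L.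
  apply: climit_ext L => k.
  rewrite (linear_mapB lV) polyV_lift !(semi_innerBl phiP) !(semi_innerBr phiP).
  rewrite -(semi_innerC phiP); ring.
pose proof (climit_Re_ge0 L (nearW _ (fun k => l0 _))) as L0; move: L0.
rewrite (linear_mapB lH) !(semi_innerBl inner_semi_inner) !(semi_innerBr inner_semi_inner).
rewrite -(semi_innerC inner_semi_inner) !(ReD, ReN); lra.
Qed.

(* The Wold projection reduces [S], so compressing to its complement leaves a
   nonnegative remainder. *)
Lemma wold_accretive l x : (forall a, 0 <= complex.Re (phi a (polyV l a))) ->
  complex.Re (inner (wold_map x) (polyH l (wold_map x))) <=
  complex.Re (phi x (polyV l x)).
Proof.
move=> l0; set y := wold_map x.
have [M M0 HM] : exists2 M, 0 <= M & norm_bound (polyH l) M.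
  apply: bounded_opP; rewrite /polyH.
  rewrite (_ : (fun f => _) = \sum_(t <- l) t.1 *: shiftw t.2); last first.
    by apply/funext => f; rewrite sumopE.
  by apply: bounded_op_sum => t; exact: bounded_opZ (bounded_shiftw _).
apply/ler_addgt0Pr => e e0.
have M1 : 0 < M + 1 by rewrite ltr_wpDl.
(* The error term is at most [(M + 1) * hnorm delta ^+ 2], which this radius keeps below [e]; [M]
   itself may be 0. *)
have eM : 0 < Num.sqrt (e / (M + 1)) by rewrite sqrtr_gt0 divr_gt0.
have [F yF] := filter_ex (truncate_cvg y eM).
pose r := [seq (y s, s) | s <- F].
have serE : ser r = truncate F y by rewrite /ser big_map.
have := wold_accretive_fin r (erefl y) l0; rewrite serE => /le_trans; apply.
rewrite lerD2l; apply: le_trans (Re_le_normc _) _.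
apply: le_trans (inner_le _ _) _.
set delta := y - _ in yF *.
apply: (@le_trans _ _ ((M + 1) * hnorm delta ^+ 2)).
  rewrite expr2 mulrCA ler_wpM2l ?hnorm_ge0 //.
  by apply: le_trans (HM _) _; rewrite ler_wpM2r ?hnorm_ge0 // lerDl.
rewrite mulrC -ler_pdivlMr // -(sqr_sqrtr (ltW (divr_gt0 e0 M1))).
by rewrite ler_sqr ?nnegrE ?hnorm_ge0 ?sqrtr_ge0 // ltW.
Qed.

End WanderingVector.

(** * The free disk system *)

Section Polynomials.
Context {R : realType} {d : nat}.
Local Notation C := R[i].
Local Notation H := (hardy R d).
Implicit Types (f g h : H) (T S : H -> H) (l : seq (C * word d)).

(** With lists in place of finitely supported functions, sums are concatenations and products are
    [app]; [evalL_polyop] and [polyop_range] show that the same operators are described. *)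
Definition polyop l : H -> H := \sum_(t <- l) t.1 *: shiftw t.2.

Lemma polyopE l f : polyop l f = polyH l f.
Proof. by rewrite /polyop sumopE. Qed.

Lemma polyop_nil : polyop [::] = 0.
Proof. by rewrite /polyop big_nil. Qed.

Lemma polyop_cons t l : polyop (t :: l) = t.1 *: shiftw t.2 + polyop l.
Proof. by rewrite /polyop big_cons. Qed.

Lemma polyop_cat l l' : polyop (l ++ l') = polyop l + polyop l'.
Proof. by rewrite /polyop big_cat. Qed.

Lemma polyop_scale a l :
  polyop [seq (a * t.1, t.2) | t <- l] = a *: polyop l.
Proof.
rewrite /polyop big_map scaler_sumr; apply: eq_bigr => t _ /=.
by rewrite scalerA.
Qed.

Lemma polyop_shiftw s : polyop [:: (1, s)] = shiftw s.
Proof. by rewrite polyop_cons polyop_nil addr0 scale1r. Qed.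

Lemma polyop_id : polyop [:: (1, [::])] = idfun.
Proof. exact: polyop_shiftw. Qed.

Lemma bounded_polyop l : bounded_op (polyop l).
Proof. by apply: bounded_op_sum => t; exact/bounded_opZ/bounded_shiftw. Qed.

Lemma evalL_polyop (Q : @ncpoly R d) : evalL Q = polyop [seq (Q w, w) | w <- finsupp Q].
Proof. by rewrite /polyop big_map. Qed.

Lemma evalL_fset (Q : @ncpoly R d) (A : {fset word d}) : (finsupp Q `<=` A)%fset ->
  evalL Q = \sum_(w <- A) Q w *: (shiftw w : H -> H).
Proof.
move=> QA; rewrite /evalL; apply: (big_fset_incl _ QA) => w _ wQ.
by rewrite fsfun_dflt // scale0r.
Qed.

Lemma polyop_range l : range evalL (polyop l).
Proof.
elim: l => [|[a v] l [P _ lP]].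
  exists [fsfun]; rewrite // polyop_nil /evalL finsupp0 big_seq_fset0 //.
pose A := (v |` finsupp P)%fset.
pose Q : @ncpoly R d := [fsfun w in A => P w + (if w == v then a else 0) | 0].
have QA : (finsupp Q `<=` A)%fset by exact: finsupp_sub.
have PA : (finsupp P `<=` A)%fset by exact: fsubsetUr.
exists Q => //; rewrite polyop_cons -lP (evalL_fset QA) (evalL_fset PA) /=.
rewrite (eq_big_seq (fun w => P w *: shiftw w +
    (if w == v then a *: shiftw v else 0))); last first.
  move=> w wA; rewrite /Q fsfunE wA scalerDl.
  by case: eqP => [->|_]; rewrite ?scale0r.
rewrite big_split /= addrC; congr (_ + _).
rewrite (big_fsetD1 v) /=; last by rewrite !inE eqxx.
rewrite eqxx big_seq big1 ?addr0 // => w.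
by rewrite in_fsetD1 => /andP[/negbTE ->].
Qed.

Lemma polyop_comp l l' : polyop l \o polyop l' = polyop (app l l').
Proof.
apply/funext => f /=; rewrite !polyopE /polyH big_allpairs_dep.
apply: eq_bigr => t _; have lt := (@bounded_shiftw R d t.2).1.
rewrite (linear_map_sum lt) scaler_sumr; apply: eq_bigr => p _ /=.
by rewrite (linear_mapZ lt) scalerA shiftw_cat.
Qed.

Definition trigop : set (H -> H) :=
  [set T | exists l l', T = polyop l + adj (polyop l')].

Lemma trigopP a T S : trigop T -> trigop S -> trigop (a *: T + S).
Proof.
move=> [l [l' ->]] [m [m' ->]].
exists ([seq (a * t.1, t.2) | t <- l] ++ m).
exists ([seq (a^* * t.1, t.2) | t <- l'] ++ m').
rewrite !polyop_cat !polyop_scale adjP ?conjCK; [|exact: bounded_polyop..].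
by rewrite scalerDr addrACA.
Qed.

Lemma trigop_polyop l : trigop (polyop l).
Proof. by exists l, [::]; rewrite polyop_nil adj0 addr0. Qed.

Lemma trigop_adj l : trigop (adj (polyop l)).
Proof. by exists [::], l; rewrite polyop_nil add0r. Qed.

Lemma trigop0 : trigop 0.
Proof. by rewrite -polyop_nil; exact: trigop_polyop. Qed.

Lemma bounded_trigop T : trigop T -> bounded_op T.
Proof.
by move=> [l [l' ->]]; apply: bounded_opD; [|apply: bounded_adj]; exact: bounded_polyop.
Qed.

(** As [L_j^* L_k] is the identity or 0, first letters cancel or annihilate until one word is empty.
    This is what puts [a^* b] in the disk system for polynomials [a] and [b], although products of
    its elements need not stay there. *)
Lemma trigop_adj_shiftw s t : trigop (adj (@shiftw R d s) \o shiftw t).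
Proof.
elim: s t => [|j s IH] [|k t].
- by rewrite adj_id -[_ \o _]/(shiftw [::]) -polyop_shiftw; exact: trigop_polyop.
- by rewrite adj_id (_ : _ \o _ = shiftw (k :: t)) // -polyop_shiftw; exact: trigop_polyop.
- by rewrite (_ : _ \o _ = adj (shiftw (j :: s))) // -polyop_shiftw; exact: trigop_adj.
have bs := @bounded_shiftw R d s; have bj := @bounded_shift R d j.
have bk := @bounded_shift R d k.
rewrite [shiftw (j :: s)]/(shift j \o shiftw s) adj_comp //.
rewrite -[_ \o _]/(adj (shiftw s) \o ((adj (shift j) \o shift k) \o shiftw t)).
rewrite adj_shift_comp; case: eqP => _; first exact: IH.
rewrite (_ : _ \o _ = 0); first exact: trigop0.
by apply/funext => f /=; rewrite (linear_map0 (bounded_adj bs).1).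
Qed.

Lemma trigop_adj_comp l l' : trigop (adj (polyop l) \o polyop l').
Proof.
elim: l => [|t l IH]; first by rewrite polyop_nil adj0; exact: trigop0.
rewrite polyop_cons adjP; [|exact: bounded_shiftw|exact: bounded_polyop].
apply: (@trigopP _ (adj (shiftw t.2) \o polyop l') _ _ IH).
elim: l' {IH} => [|u l' IH].
  rewrite polyop_nil (_ : _ \o _ = 0); first exact: trigop0.
  by apply/funext => f /=; rewrite (linear_map0 (bounded_adj (bounded_shiftw _)).1).
rewrite polyop_cons.
rewrite (_ : _ \o _ = u.1 *: (adj (shiftw t.2) \o shiftw u.2) +
  (adj (shiftw t.2) \o polyop l')).
  exact: trigopP (trigop_adj_shiftw _ _) IH.
by apply/funext => f /=; rewrite !fctE (bounded_adj (bounded_shiftw _)).1.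
Qed.

Lemma opclosure_sub (X : set (H -> H)) T : bounded_op T -> X T -> opclosure X T.
Proof.
move=> bT XT; split => // e e0; exists T => //; rewrite subrr.
apply: le_lt_trans e0; apply: opnorm_le => // f.
by rewrite mul0r hnorm0.
Qed.

Lemma norm_boundD T S (M N : R) :
  norm_bound T M -> norm_bound S N -> norm_bound (T + S) (M + N).
Proof.
by move=> TM SN f; rewrite mulrDl; apply: le_trans (hnormD _ _) _; exact: lerD.
Qed.

Lemma opclosure_approx (X : set (H -> H)) T (e : R) :
  (forall S, X S -> bounded_op S) -> opclosure X T -> 0 < e ->
  exists2 S, X S & norm_bound (T - S) e.
Proof.
move=> bX [bT TX] e0; have [S XS TS] := TX _ e0; exists S => // f.
apply: le_trans (opnorm_bound (bounded_opB bT (bX _ XS)) f) _.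
by rewrite ler_wpM2r ?hnorm_ge0 // ltW.
Qed.

Lemma disk_algebra_bounded T : disk_algebra T -> bounded_op T.
Proof. by case. Qed.

Lemma disk_algebra_polyop l : disk_algebra (polyop l).
Proof. exact: opclosure_sub (bounded_polyop l) (polyop_range l). Qed.

Lemma disk_algebra_approx T (e : R) : disk_algebra T -> 0 < e ->
  exists l, norm_bound (T - polyop l) e.
Proof.
move=> dT e0; have [|_ [Q _ <-] TQ] := opclosure_approx _ dT e0.
  by move=> _ [Q _ <-]; rewrite evalL_polyop; exact: bounded_polyop.
by exists [seq (Q w, w) | w <- finsupp Q]; rewrite -evalL_polyop.
Qed.

Lemma disk_system_bounded T : disk_system T -> bounded_op T.
Proof. by case. Qed.

Lemma trigop_disk_sum T : trigop T ->
  [set a + b | a in disk_algebra & b in adj @` disk_algebra] T.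
Proof.
move=> [l [l' ->]]; exists (polyop l); first exact: disk_algebra_polyop.
exists (adj (polyop l')) => //; exists (polyop l') => //.
exact: disk_algebra_polyop.
Qed.

Lemma disk_system_trigop T : trigop T -> disk_system T.
Proof.
by move=> tT; apply: opclosure_sub (bounded_trigop tT) (trigop_disk_sum tT).
Qed.

Lemma disk_system_approx T (e : R) : disk_system T -> 0 < e ->
  exists2 S, trigop S & norm_bound (T - S) e.
Proof.
move=> dT e0; have e20 : 0 < e / 2 by rewrite divr_gt0.
have e40 : 0 < e / 2 / 2 by rewrite divr_gt0.
have [|_ [a da [_ [b db <-] <-]] Tab] := opclosure_approx _ dT e20.
  move=> _ [a da [_ [b db <-] <-]].
  by apply: bounded_opD; [|apply: bounded_adj]; exact: disk_algebra_bounded.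
have [l al] := disk_algebra_approx da e40.
have [l' bl'] := disk_algebra_approx db e40.
have {}bl' : norm_bound (adj b - adj (polyop l')) (e / 2 / 2).
  have bb := disk_algebra_bounded db; have bl := bounded_polyop l'.
  have := adjP (-1) bl bb; rewrite rmorphN1 !scaleN1r ![- _ + _]addrC => <-.
  exact: norm_bound_adj (bounded_opB bb bl) bl'.
exists (polyop l + adj (polyop l')); first by exists l, l'.
have -> : T - (polyop l + adj (polyop l')) =
    (T - (a + adj b)) + ((a - polyop l) + (adj b - adj (polyop l'))).
  by rewrite [(a - _) + _]addrACA -opprD addrA subrK.
rewrite (_ : e = e / 2 + (e / 2 / 2 + e / 2 / 2)); last by rewrite -!splitr.
exact: norm_boundD Tab (norm_boundD al bl').
Qed.

Lemma disk_systemP a T S : disk_system T -> disk_system S ->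
  disk_system (a *: T + S).
Proof.
move=> dT dS; split.
  exact: bounded_opD (bounded_opZ _ (disk_system_bounded dT)) (disk_system_bounded dS).
(* The two errors add up to [normc a + 1] times the tolerance; dividing by [normc a + 2] makes the
   final inequality strict. *)
move=> e e0; have a1 : 0 < normc a + 2 by rewrite ltr_wpDl ?normc_ge0.
have ea : 0 < e / (normc a + 2) by rewrite divr_gt0.
have [T' tT' TT'] := disk_system_approx dT ea.
have [S' tS' SS'] := disk_system_approx dS ea.
exists (a *: T' + S'); first exact: trigop_disk_sum (trigopP a tT' tS').
apply: (@le_lt_trans _ _ ((normc a + 1) * (e / (normc a + 2)))); last first.
  by rewrite mulrCA gtr_pMr // ltr_pdivrMr // mul1r ltrD2l ltr1n.
apply: opnorm_le; first by rewrite mulr_ge0 ?addr_ge0 ?normc_ge0 // ltW.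
rewrite opprD addrACA -scalerBr mulrDl mul1r; apply: norm_boundD => // f.
by rewrite hnormZ -mulrA ler_wpM2l ?normc_ge0.
Qed.

Lemma disk_systemD T S : disk_system T -> disk_system S -> disk_system (T + S).
Proof. by move=> dT dS; rewrite -[T]scale1r; exact: disk_systemP. Qed.

Lemma disk_system0 : disk_system (0 : H -> H).
Proof. exact: disk_system_trigop trigop0. Qed.

Lemma disk_systemZ a T : disk_system T -> disk_system (a *: T).
Proof. by move=> dT; rewrite -[_ *: _]addr0; exact: disk_systemP dT disk_system0. Qed.

Lemma disk_systemB T S : disk_system T -> disk_system S -> disk_system (T - S).
Proof. by move=> dT dS; rewrite addrC -scaleN1r; exact: disk_systemP. Qed.

Lemma disk_system_id : disk_system (idfun : H -> H).
Proof. by rewrite -polyop_id; exact: disk_system_trigop (trigop_polyop _). Qed.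

(** A submodule predicate, so that polynomial operators form a module [ncop] that can serve as the
    space [V] of the wandering-vector construction. *)
Definition ncoperator : {pred (H -> H)} := fun T => `[< exists l, T = polyop l >].

Lemma ncoperator_submod : submod_closed ncoperator.
Proof.
split; first by apply/asboolP; exists [::]; rewrite polyop_nil.
move=> a T S /asboolP[l ->] /asboolP[l' ->]; apply/asboolP.
by exists ([seq (a * t.1, t.2) | t <- l] ++ l'); rewrite polyop_cat polyop_scale.
Qed.

HB.instance Definition _ :=
  GRing.isSubmodClosed.Build C (H -> H) ncoperator ncoperator_submod.

End Polynomials.

Record ncop (R : realType) (d : nat) := Ncop {
  opval :> hardy R d -> hardy R d;
  opvalP : opval \in ncoperator }.

HB.instance Definition _ (R : realType) (d : nat) := [isSub for @opval R d].
HB.instance Definition _ (R : realType) (d : nat) := [Choice of ncop R d by <:].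
HB.instance Definition _ (R : realType) (d : nat) :=
  [SubChoice_isSubLmodule of ncop R d by <:].

(** * Nc measures and vector states *)

Section NcMeasures.
Context {R : realType} {d : nat}.
Local Notation C := R[i].
Local Notation H := (hardy R d).
Local Notation V := (ncop R d).
Implicit Types (f g h : H) (T S : H -> H) (l : seq (C * word d)) (a b : V).

Lemma ncopP a : exists l, (a : H -> H) = polyop l.
Proof. by have /asboolP := opvalP a. Qed.

Lemma bounded_ncop a : bounded_op a.
Proof. by have [l ->] := ncopP a; exact: bounded_polyop. Qed.

Lemma polyop_ncoperator l : polyop l \in @ncoperator R d.
Proof. by apply/asboolP; exists l. Qed.

Definition ncop_of l : V := Ncop (polyop_ncoperator l).

Definition ncop1 : V := ncop_of [:: (1, [::])].

Lemma opval1 : (ncop1 : H -> H) = idfun.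
Proof. exact: polyop_id. Qed.

Lemma nshift_subproof (j : 'I_d) a : (shift j \o a) \in @ncoperator R d.
Proof.
have [l ->] := ncopP a; apply/asboolP; exists (app [:: (1, [:: j])] l).
by rewrite -polyop_comp polyop_shiftw.
Qed.

Definition nshift j a : V := Ncop (nshift_subproof j a).

Lemma nshift_linear j : linear (nshift j).
Proof.
move=> x a b; apply: val_inj; apply/funext => f /=.
by rewrite !fctE (@shift_linear R d j).
Qed.

Lemma opval_wordop s a : (wordop nshift s a : H -> H) = shiftw s \o a.
Proof. by elim: s => [|j s IH] //=; rewrite IH. Qed.

Lemma opval_linear x a b : (x *: a + b : V) = x *: (a : H -> H) + (b : H -> H) :> (H -> H).
Proof. by []. Qed.

Lemma opval_sum I (r : seq I) (F : I -> V) :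
  (\sum_(i <- r) F i : V) = \sum_(i <- r) (F i : H -> H) :> (H -> H).
Proof. exact: (big_morph (@opval R d)). Qed.

Lemma opval_polyV l a : (polyV nshift l a : H -> H) = polyop l \o a.
Proof.
rewrite /polyV opval_sum; apply/funext => f /=.
rewrite polyopE sumopE /polyH; apply: eq_bigr => t _.
by rewrite -[LHS]/(t.1 *: (wordop nshift t.2 a : H -> H) f) opval_wordop.
Qed.

(** An element of [ncop] keeps no list of coefficients; they are recovered from its action on the
    series 1. *)
Definition const_coef a : C := a (hone : H) [::].

Lemma const_coef_scalar : scalar const_coef.
Proof. by move=> x a b; rewrite /const_coef opval_linear. Qed.

Lemma const_coef_nshift j a : const_coef (nshift j a) = 0.
Proof. by []. Qed.

Lemma const_coef1 : const_coef ncop1 = 1.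
Proof. by rewrite /const_coef opval1. Qed.

Lemma evalL_hone (Q : @ncpoly R d) v : evalL Q (hone : H) v = Q v.
Proof.
rewrite evalL_polyop polyopE /polyH big_map.
under eq_bigr do rewrite /= /hone shiftw_monomial cats0.
by rewrite coef_fsum; case: ifPn => // /fsfun_dflt ->.
Qed.

Variable mu : (H -> H) -> C.
Hypothesis hmu : nc_measure mu.

Lemma nc_measureP x T S : disk_system T -> disk_system S ->
  mu (x *: T + S) = x * mu T + mu S.
Proof. exact: hmu.1. Qed.

Lemma nc_measure_ge0 T : disk_system T -> positive_op T -> 0 <= mu T.
Proof. exact: hmu.2. Qed.

Lemma nc_measureD T S : disk_system T -> disk_system S -> mu (T + S) = mu T + mu S.
Proof. by move=> dT dS; have := nc_measureP 1 dT dS; rewrite scale1r mul1r. Qed.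

Lemma nc_measure0 : mu 0 = 0.
Proof.
have := nc_measureD disk_system0 disk_system0; rewrite addr0 => /esym/eqP.
by rewrite -subr_eq0 addrK => /eqP.
Qed.

Lemma nc_measureZ x T : disk_system T -> mu (x *: T) = x * mu T.
Proof.
by move=> dT; have := nc_measureP x dT disk_system0; rewrite nc_measure0 !addr0.
Qed.

Lemma nc_measureB T S : disk_system T -> disk_system S -> mu (T - S) = mu T - mu S.
Proof.
move=> dT dS; rewrite [T - S]addrC -[- S]scaleN1r (nc_measureP _ dS dT) mulN1r.
exact: addrC.
Qed.

Lemma nc_measure_mono T S : disk_system T -> disk_system S ->
  positive_op (S - T) -> complex.Re (mu T) <= complex.Re (mu S).
Proof.
move=> dT dS /(nc_measure_ge0 (disk_systemB dS dT)) /ge0_Re.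
by rewrite (nc_measureB dS dT) ReB subr_ge0.
Qed.

Definition gns_form a b : C := mu (adj a \o b).

Lemma disk_system_gns a b : disk_system (adj a \o b).
Proof.
have [l ->] := ncopP a; have [l' ->] := ncopP b.
exact: disk_system_trigop (trigop_adj_comp _ _).
Qed.

Lemma positive_adj_comp a : positive_op (adj a \o a).
Proof.
have ba := bounded_ncop a; split.
  exact: bounded_op_comp (bounded_adj ba) ba.
move=> f /=; rewrite inner_adjr //; exact: semi_inner_ge0 inner_semi_inner _.
Qed.

Lemma gns_semi_inner : semi_inner gns_form.
Proof.
split=> [x a b e|x a b e|a]; rewrite /gns_form.
- rewrite -(nc_measureP _ (disk_system_gns _ _) (disk_system_gns _ _)); congr (mu _).
  apply/funext => f /=; rewrite !fctE.
  by rewrite -(bounded_adj (bounded_ncop e)).1.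
- rewrite -(nc_measureP _ (disk_system_gns _ _) (disk_system_gns _ _)); congr (mu _).
  by rewrite opval_linear (adjP _ (bounded_ncop _) (bounded_ncop _)).
- exact: nc_measure_ge0 (disk_system_gns a a) (positive_adj_comp a).
Qed.

Lemma gns_nshift j k a b :
  gns_form (nshift j a) (nshift k b) = if j == k then gns_form a b else 0.
Proof.
have ba := bounded_ncop a; rewrite /gns_form /= adj_comp //; last exact: bounded_shift.
rewrite -[_ \o _]/(adj a \o ((adj (shift j) \o shift k) \o b)) adj_shift_comp.
case: eqP => // _; rewrite -[RHS]nc_measure0; congr (mu _).
by apply/funext => f /=; rewrite (linear_map0 (bounded_adj ba).1).
Qed.

Lemma christoffel0_bounds a : const_coef a = 1 ->
  0 <= christoffel0 mu <= complex.Re (gns_form a a).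
Proof.
move=> a1; pose X := [set complex.Re (mu (adj (evalL Q) \o evalL Q))
      | Q in [set Q : @ncpoly R d | Q [::] = 1]].
have X0 : lbound X 0.
  move=> _ [Q _ <-]; rewrite evalL_polyop.
  exact: (semi_inner_Re_ge0 gns_semi_inner (ncop_of _)).
have Xa : X (complex.Re (gns_form a a)).
  have [l al] := ncopP a; have [Q _ Ql] := @polyop_range R d l.
  exists Q => /=; last by rewrite /gns_form al Ql.
  by rewrite -evalL_hone Ql -al.
apply/andP; split; last by apply: ge_inf => //; exists 0.
by apply: lb_le_inf => //; exists (complex.Re (gns_form a a)).
Qed.

(** The defining infimum made homogeneous by rescaling to constant coefficient 1; this is the
    inequality [lam_le] that makes [defect] positive. *)
Lemma christoffel0_const_coef a :
  christoffel0 mu * normc (const_coef a) ^+ 2 <= complex.Re (gns_form a a).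
Proof.
have [a0|a0] := eqVneq (const_coef a) 0.
  by rewrite a0 normc0 expr0n mulr0 (semi_inner_Re_ge0 gns_semi_inner).
set z := const_coef a.
have /christoffel0_bounds/andP[_] : const_coef (z^-1 *: a) = 1.
  by rewrite (linear_mapZ (W := C^o) const_coef_scalar) /GRing.scale /= mulVf.
rewrite -(sqr_semi_norm gns_semi_inner) (semi_normZ gns_semi_inner) exprMn.
rewrite (sqr_semi_norm gns_semi_inner) normcV exprVn mulrC ler_pdivlMr //.
rewrite exprn_gt0 // lt_def normc_ge0 andbT.
by apply: contra_neq a0 => /eq0_normc.
Qed.

Lemma christoffel0_minimizing : exists w : nat -> V,
  (forall k, const_coef (w k) = 1) /\
  (forall e : R, 0 < e -> \forall k \near \oo,
     complex.Re (gns_form (w k) (w k)) < christoffel0 mu + e).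
Proof.
have ex (k : nat) : exists a, const_coef a = 1 /\
    complex.Re (gns_form a a) < christoffel0 mu + k.+1%:R^-1.
  have k0 : 0 < k.+1%:R^-1 :> R by rewrite invr_gt0.
  pose X := [set complex.Re (mu (adj (evalL Q) \o evalL Q))
      | Q in [set Q : @ncpoly R d | Q [::] = 1]].
  have hX : has_inf X.
    split.
      have [Q _ Q1] := @polyop_range R d [:: (1, [::])].
      exists (complex.Re (mu (adj (evalL Q) \o evalL Q))); exists Q => //=.
      by rewrite -evalL_hone Q1 polyop_id.
    exists 0 => _ [Q _ <-]; rewrite evalL_polyop.
    exact: (semi_inner_Re_ge0 gns_semi_inner (ncop_of _)).
  have [_ [Q /= Q1 <-] Qk] := inf_adherent k0 hX.
  move: Qk; rewrite evalL_polyop => Qk; exists (ncop_of [seq (Q w, w) | w <- finsupp Q]).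
  by split => //; rewrite /const_coef /= -evalL_polyop evalL_hone.
have [w wP] := choice ex; exists w; split=> [k|e e0]; first by have [] := wP k.
near=> k; have [_ /lt_trans] := wP k; apply.
rewrite ltrD2l; near: k; exact: near_infty_natSinv_lt (PosNum e0).
Unshelve. all: by end_near. Qed.

Definition vector_state h T : C := inner h (T h).

Lemma vector_state_measure h : nc_measure (vector_state h).
Proof.
split=> [x S T _ _|T _ [_ T0]]; last exact: T0.
by rewrite /vector_state !fctE (semi_innerPr inner_semi_inner).
Qed.

Lemma positive_opP T : bounded_op T -> (forall f, complex.Im (inner f (T f)) = 0) ->
  (forall f, 0 <= complex.Re (inner f (T f))) -> positive_op T.
Proof. by move=> bT ImT ReT; split => // f; rewrite lecE ReT ImT eqxx. Qed.

(* If [A + B^*] approximates [T] up to [e], take for [P] the polynomial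
   [(A + B) / 2 + e / 2]: then [P + P^*] has the real quadratic form of
   [A + B^* + e]. *)
Lemma positive_sandwich T (e : R) : disk_system T -> positive_op T -> 0 < e ->
  exists l, [/\ positive_op (polyop l + adj (polyop l)),
    positive_op (polyop l + adj (polyop l) - T) &
    positive_op (T + (2 * e)%:C *: idfun - (polyop l + adj (polyop l)))].
Proof.
move=> dT pT e0; have bT := disk_system_bounded dT.
have [_ [l [l' ->]] TS] := disk_system_approx dT e0.
pose m := [seq (2^-1 * t.1, t.2) | t <- l ++ l'] ++ [:: ((e / 2)%:C, [::])].
exists m.
have mE : polyop m = 2^-1 *: (polyop l + polyop l') + (e / 2)%:C *: (idfun : H -> H).
  by rewrite polyop_cat polyop_scale polyop_cat polyop_cons polyop_nil addr0.
have bl := bounded_polyop l; have bl' := bounded_polyop l'.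
have bm := bounded_polyop m.
have bP : bounded_op (polyop m + adj (polyop m)) := bounded_opD bm (bounded_adj bm).
set P := polyop m + _ in bP *.
have ImP f : complex.Im (inner f (P f)) = 0.
  rewrite /P fctE (semi_innerDr inner_semi_inner) inner_adjr //.
  rewrite (semi_innerC inner_semi_inner f).
  by case: (inner f _) => x y; rewrite conjE /= subrr.
have ImT f : complex.Im (inner f (T f)) = 0 by apply: ger0_Im; exact: pT.2.
have ReT f : 0 <= complex.Re (inner f (T f)) by apply: ge0_Re; exact: pT.2.
have ReP f : complex.Re (inner f (P f)) =
    complex.Re (inner f ((polyop l + adj (polyop l')) f)) + e * hnorm f ^+ 2.
  rewrite /P !fctE !(semi_innerDr inner_semi_inner) !inner_adjr //.
  rewrite (semi_innerC inner_semi_inner f (polyop m f)).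
  rewrite (semi_innerC inner_semi_inner f (polyop l' f)).
  rewrite !ReD !ReJ mE !fctE (semi_innerDr inner_semi_inner).
  rewrite !(semi_innerZr inner_semi_inner) (semi_innerDr inner_semi_inner).
  rewrite (_ : 2^-1 = (2^-1)%:C); last by rewrite fmorphV rmorph_nat.
  by rewrite ReD !Re_mulC sqr_hnorm ReD /=; field.
(* The form of [P] is that of the approximant raised by [e], and the approximant is within [e] of
   [T]: hence [T] below [P], and [P] below [T + 2 e]. *)
have close f : `|complex.Re (inner f (T f)) -
    complex.Re (inner f ((polyop l + adj (polyop l')) f))| <= e * hnorm f ^+ 2.
  rewrite -ReB -(semi_innerBr inner_semi_inner).
  apply: le_trans (absRe_le_normc _) _; apply: le_trans (inner_le _ _) _.
  by rewrite expr2 mulrCA ler_wpM2l ?hnorm_ge0 //; exact: TS.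
have le1 f : complex.Re (inner f (T f)) <= complex.Re (inner f (P f)).
  by rewrite ReP; have := close f; rewrite ler_norml => /andP[_]; lra.
have ImB (z t : C) : complex.Im (z - t) = complex.Im z - complex.Im t.
  by case: z t => ? ? [].
have ImD (z t : C) : complex.Im (z + t) = complex.Im z + complex.Im t.
  by case: z t => ? ? [].
split; apply: positive_opP => //.
- by move=> f; exact: le_trans (ReT f) (le1 f).
- exact: bounded_opB.
- by move=> f; rewrite fctE (semi_innerBr inner_semi_inner) ImB ImP ImT subrr.
- by move=> f; rewrite fctE (semi_innerBr inner_semi_inner) ReB subr_ge0.
- exact: bounded_opB (bounded_opD bT (bounded_opZ _ bounded_op_id)) bP.
- move=> f; rewrite !fctE (semi_innerBr inner_semi_inner) (semi_innerDr inner_semi_inner).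
  rewrite (semi_innerZr inner_semi_inner) ImB ImD ImP ImT subr0 add0r.
  by rewrite inner_self /= mulr0 mul0r addr0.
- move=> f; rewrite !fctE (semi_innerBr inner_semi_inner) (semi_innerDr inner_semi_inner).
  rewrite (semi_innerZr inner_semi_inner) ReB ReD Re_mulC ReP.
  rewrite -[inner f (idfun f)]/(inner f f) -(sqr_hnorm f).
  by have := close f; rewrite ler_norml => /andP[+ _]; lra.
Qed.

(** Replacing [T] by a sandwiching [P + P^*] costs at most a small multiple of [mu idfun].
    Monotonicity of [mu] on positive operators provides this, so no continuity of [mu] has to be
    established. *)
Lemma vector_state_le h :
  (forall l, (forall a, 0 <= complex.Re (gns_form a (polyV nshift l a))) ->
    complex.Re (inner h (polyop l h)) <= complex.Re (gns_form ncop1 (ncop_of l))) ->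
  nc_measure_le (vector_state h) mu.
Proof.
move=> hP T dT pT.
rewrite ge0_le_Re; [|exact: pT.2|exact: nc_measure_ge0].
apply/ler_addgt0Pr => e e0.
have m1 : 0 <= complex.Re (mu idfun).
  apply/ge0_Re/(nc_measure_ge0 disk_system_id); split; first exact: bounded_op_id.
  by move=> f; exact: semi_inner_ge0 inner_semi_inner _.
(* Chosen so that [2 * e' * mu idfun] is at most [e]; the added 1 keeps the denominator positive. *)
pose e' := e / (2 * (complex.Re (mu idfun) + 1)).
have m2 : 0 < 2 * (complex.Re (mu idfun) + 1) by rewrite mulr_gt0 // ltr_wpDl.
have e'0 : 0 < e' by rewrite divr_gt0.
have [l [pP pPT pTP]] := positive_sandwich dT pT e'0.
have bl := bounded_polyop l.
set P := polyop l + _ in pP pPT pTP.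
have dl := disk_system_trigop (trigop_polyop l).
have dal := disk_system_trigop (trigop_adj l).
have dP : disk_system P := disk_systemD dl dal.
have muadj : mu (adj (polyop l)) = (gns_form ncop1 (ncop_of l))^*.
  by rewrite -(semi_innerC gns_semi_inner) /gns_form opval1.
have muP : complex.Re (mu P) = 2 * complex.Re (gns_form ncop1 (ncop_of l)).
  rewrite (nc_measureD dl dal) muadj ReD ReJ {1}/gns_form opval1 adj_id.
  by rewrite (_ : idfun \o _ = polyop l) // /gns_form opval1 adj_id; lra.
(* With [b] the product of the polynomial [l] and [a], the positive operator [a^* P a] is
   [a^* b + b^* a], whose measure is twice the real part of [gns_form a b]. *)
have acc a : 0 <= complex.Re (gns_form a (polyV nshift l a)).
  have ba := bounded_ncop a.
  pose b : V := polyV nshift l a.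
  have bE : (b : H -> H) = polyop l \o a by exact: opval_polyV.
  have sumE : adj a \o (P \o a) = (adj a \o b) + (adj b \o a).
    rewrite bE adj_comp //; apply/funext => f.
    by rewrite /P /= !fctE (linear_mapD (bounded_adj ba).1).
  have : 0 <= mu (adj a \o (P \o a)).
    apply: nc_measure_ge0.
      by rewrite sumE; apply: disk_systemD; exact: disk_system_gns.
    split; last by move=> f /=; rewrite inner_adjr //; exact: pP.2.
    exact: bounded_op_comp (bounded_adj ba) (bounded_op_comp pP.1 ba).
  rewrite sumE (nc_measureD (disk_system_gns _ _) (disk_system_gns _ _)).
  rewrite -/(gns_form a b) -/(gns_form b a) (semi_innerC gns_semi_inner a b).
  by move=> /ge0_Re; rewrite ReD ReJ; lra.
have dT1 : disk_system (T + (2 * e')%:C *: (idfun : H -> H)).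
  exact: disk_systemD dT (disk_systemZ _ disk_system_id).
have := nc_measure_mono dP dT1 pTP.
rewrite (nc_measureD dT (disk_systemZ _ disk_system_id)).
rewrite (nc_measureZ _ disk_system_id).
rewrite ReD Re_mulC muP => leT.
have : complex.Re (vector_state h T) <= complex.Re (inner h (P h)).
  have := ge0_Re (pPT.2 h).
  by rewrite fctE (semi_innerBr inner_semi_inner) ReB subr_ge0.
rewrite /P fctE (semi_innerDr inner_semi_inner) inner_adjr //.
rewrite (semi_innerC inner_semi_inner h) ReD ReJ => leh.
have := hP l acc.
have : 2 * e' * complex.Re (mu idfun) <= e.
  rewrite -[leRHS](_ : 2 * e' * (complex.Re (mu idfun) + 1) = e); last first.
    rewrite /e'; field; apply: lt0r_neq0; move: m2; lra.
  by rewrite ler_wpM2l ?lerDl // mulr_ge0 // ltW.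
by move: leh leT; lra.
Qed.

End NcMeasures.

(** * Absolutely continuous vector states *)

Section AbsoluteContinuity.
Context {R : realType} {d : nat}.
Local Notation C := R[i].
Local Notation H := (hardy R d).
Implicit Types (f g h : H) (T : H -> H).

(** The factorizations of [s] into two words are its cuts at positions 0 to [size s], so every
    coefficient of a product of power series is a finite sum. *)
Definition cauchy_prod (f h : word d -> C) (s : word d) : C :=
  \sum_(i < (size s).+1) f (take i s) * h (drop i s).

Lemma cauchy_prod_linear h a f g s :
  cauchy_prod (a *: f + g) h s = a * cauchy_prod f h s + cauchy_prod g h s.
Proof.
rewrite /cauchy_prod mulr_sumr -big_split; apply: eq_bigr => i _.
by rewrite coefD coefZ /=; ring.
Qed.

Lemma cauchy_prod_shift j f h s : cauchy_prod (shift j f) h s =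
  if s is k :: v then (if k == j then cauchy_prod f h v else 0) else 0.
Proof.
case: s => [|k v]; first by rewrite /cauchy_prod big_ord1 shift_nil mul0r.
(* The cut at 0 contributes nothing, as [shift j f] has no constant coefficient; the other cuts of
   [k :: v] are the cuts of [v]. *)
rewrite /cauchy_prod big_ord_recl take0 shift_nil mul0r add0r.
case: eqP => [->|/eqP/negbTE kj]; last first.
  by rewrite big1 // => i _; rewrite /= kj mul0r.
by apply: eq_bigr => i _; rewrite /= eqxx.
Qed.

Lemma cauchy_prod_polyop l h s :
  polyop l h s = cauchy_prod (polyop l (hone : H)) h s.
Proof.
elim: l => [|t l IH].
  by rewrite polyop_nil /cauchy_prod big1 // => i _; rewrite mul0r.
rewrite polyop_cons !fctE cauchy_prod_linear coefD coefZ {}IH; congr (_ * _ + _).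
elim: t.2 s => [|j v IH] s.
  rewrite /cauchy_prod big_ord_recl take0 drop0 /= mul1r big1 ?addr0 // => i _.
  by case: s i => [|k s] [i ?]; rewrite //= mul0r.
by rewrite [shiftw _]/= cauchy_prod_shift; case: s => [|k s] //=; rewrite IH.
Qed.

(** For polynomials this is [cauchy_prod_polyop]; for fixed [h] and [s] both sides depend
    continuously on [T] in operator norm, and [M] bounds the two Lipschitz constants together. *)
Lemma cauchy_prod_disk_algebra T h s : disk_algebra T ->
  T h s = cauchy_prod (T (hone : H)) h s.
Proof.
move=> dT; apply/eqP; rewrite -subr_eq0; apply/eqP/eq0_normc/le_anti.
rewrite normc_ge0 andbT; apply/ler_addgt0Pr => e e0; rewrite add0r.
pose M := hnorm h + \sum_(i < (size s).+1) hnorm (hone : H) * normc (h (drop i s)).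
have M0 : 0 <= M.
  by rewrite addr_ge0 ?hnorm_ge0 // sumr_ge0 // => i _; rewrite mulr_ge0 ?hnorm_ge0 ?normc_ge0.
have M1 : 0 < M + 1 by rewrite ltr_wpDl.
have e'0 : 0 < e / (M + 1) by rewrite divr_gt0.
have [l Tl] := disk_algebra_approx dT e'0; set e' := e / _ in e'0 Tl.
set S := polyop l in Tl.
have -> : T h s - cauchy_prod (T hone) h s =
    (T - S) h s - cauchy_prod ((T - S) hone) h s.
  rewrite !fctE (_ : T hone - S hone = -1 *: S hone + T hone); last first.
    by rewrite scaleN1r addrC.
  rewrite cauchy_prod_linear coefB cauchy_prod_polyop; ring.
apply: le_trans (normcB_le _ _) _.
apply: (@le_trans _ _ (e' * M)); last first.
  by rewrite /e' mulrAC ler_pdivrMr // ler_pM2l // lerDl.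
rewrite mulrDr lerD //; first exact: le_trans (coef_le _ _) (Tl _).
rewrite /cauchy_prod mulr_sumr.
elim/big_ind2: _ => [|x1 y1 x2 y2 le1 le2|i _].
- by rewrite normc0.
- exact: le_trans (le_normcD _ _) (lerD le1 le2).
- rewrite normcM mulrA ler_wpM2r ?normc_ge0 //.
  exact: le_trans (coef_le _ _) (Tl _).
Qed.

Definition mult_dom h : set H := [set f | cauchy_prod f h \in sqsummable].

(* The product [f h] of power series, with junk value 0 if it is not square
   summable. *)
Definition mult h f : H := insubd 0 (cauchy_prod f h).

Lemma multE h f s : mult_dom h f -> mult h f s = cauchy_prod f h s.
Proof. by move=> fh; rewrite /mult -[coef _]/(val _) val_insubd fh. Qed.

Lemma mult_domP h f g : (forall s, cauchy_prod f h s = g s) ->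
  mult_dom h f /\ mult h f = g.
Proof.
move=> fg; have fh : mult_dom h f.
  rewrite /mult_dom /= (_ : cauchy_prod f h = coef g); first by case: g {fg}.
  exact/funext.
by split => //; apply: hardyP => s; rewrite multE.
Qed.

Lemma mult_linear h a f g : mult_dom h f -> mult_dom h g ->
  mult_dom h (a *: f + g) /\ mult h (a *: f + g) = a *: mult h f + mult h g.
Proof.
move=> fh gh; apply: mult_domP => s.
by rewrite cauchy_prod_linear coefD coefZ !multE.
Qed.

Definition mult_form h : qform :=
  QForm (mult_dom h) (fun f g => inner (mult h f) (mult h g)).

Lemma mult_form_positive h : positive_form (mult_form h).
Proof.
split=> /=.
- by case: (@mult_domP h 0 0) => // s; rewrite /cauchy_prod big1 // => i _; rewrite mul0r.
- by move=> a f g fh gh; case: (mult_linear a fh gh).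
- move=> a f g k fh gh _; have [_ ->] := mult_linear a fh gh.
  exact: semi_innerPr inner_semi_inner _ _ _ _.
- move=> a f g k fh gh _; have [_ ->] := mult_linear a fh gh.
  exact: semi_innerPl inner_semi_inner _ _ _ _.
- by move=> f _; exact: semi_inner_ge0 inner_semi_inner _.
Qed.

Lemma form_norm_mult h f :
  form_norm (mult_form h) f = Num.sqrt (hnorm (mult h f) ^+ 2 + hnorm f ^+ 2).
Proof. by rewrite /form_norm /= (sqr_hnorm (mult h f)). Qed.

Lemma hnorm_mult_le h f : hnorm (mult h f) <= form_norm (mult_form h) f.
Proof.
by rewrite form_norm_mult -[leLHS]ger0_norm ?hnorm_ge0 // -sqrtr_sqr
  ler_wsqrtr // lerDl sqr_ge0.
Qed.

Lemma hnorm_le_form h f : hnorm f <= form_norm (mult_form h) f.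
Proof.
by rewrite form_norm_mult -[leLHS]ger0_norm ?hnorm_ge0 // -sqrtr_sqr
  ler_wsqrtr // lerDr sqr_ge0.
Qed.

Lemma form_norm_le h f (e : R) : 0 <= e -> hnorm (mult h f) <= e -> hnorm f <= e ->
  form_norm (mult_form h) f <= 2 * e.
Proof.
move=> e0 m1 m2; rewrite form_norm_mult -[leRHS]ger0_norm ?mulr_ge0 //.
rewrite -sqrtr_sqr ler_wsqrtr //.
have := hnorm_ge0 (mult h f); have := hnorm_ge0 f.
move: (hnorm _) (hnorm _) m1 m2 => x y *; nra.
Qed.

Lemma mult_domB h f g : mult_dom h f -> mult_dom h g ->
  mult_dom h (f - g) /\ mult h (f - g) = mult h f - mult h g.
Proof.
move=> fh gh; have := mult_linear (-1) gh fh.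
by rewrite !scaleN1r ![- _ + _]addrC.
Qed.

(* The two limits match because each coefficient of a product is a finite sum. *)
Lemma mult_form_closed h : closed_form (mult_form h).
Proof.
move=> u uh uC.
have [|f uf] := @hardy_complete R d u.
  move=> e /uC[N uN]; exists N => m n Nm Nn.
  exact: le_lt_trans (hnorm_le_form h _) (uN _ _ Nm Nn).
have [|g mug] := @hardy_complete R d (fun n => mult h (u n)).
  move=> e /uC[N uN]; exists N => m n Nm Nn.
  have [_ <-] := mult_domB (uh m) (uh n).
  exact: le_lt_trans (hnorm_mult_le h _) (uN _ _ Nm Nn).
have lim_coef (v : nat -> H) k s : (forall e : R, 0 < e -> exists N, forall n,
    (N <= n)%N -> hnorm (v n - k) <= e) -> climit \oo (fun n => v n s) (k s).
  move=> vk e e0; have e20 : 0 < e / 2 by rewrite divr_gt0.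
  have [N vN] := vk _ e20; exists N => // n Nn.
  apply: le_lt_trans (coef_le (v n - k) s) _; apply: le_lt_trans (vN _ Nn) _.
  by rewrite ltr_pdivrMr // ltr_pMr // ltr1n.
have [fh mf] : mult_dom h f /\ mult h f = g.
  apply: mult_domP => s.
  have Lg := lim_coef _ _ s mug.
  have Lf : climit \oo (fun n => cauchy_prod (u n) h s) (cauchy_prod f h s).
    apply: climit_sum => i.
    have Li : climit \oo (fun n => u n (take i s)) (f (take i s)) by exact: lim_coef.
    rewrite mulrC; apply: climit_ext (climitM (h (drop i s)) Li) => n.
    by rewrite mulrC.
  apply: (climit_uniq Lf); apply: climit_ext Lg => n.
  by rewrite multE //; exact: uh.
exists f => //; apply/cvgrPdist_le => e e0.
have e20 : 0 < e / 2 by rewrite divr_gt0.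
have [N1 uN] := uf _ e20; have [N2 muN] := mug _ e20.
exists (maxn N1 N2) => // n; rewrite /= geq_max => /andP[n1 n2].
rewrite sub0r normrN ger0_norm ?sqrtr_ge0 //.
rewrite (_ : e = 2 * (e / 2)); last by field.
apply: form_norm_le; [exact: ltW| |exact: uN].
by have [_ ->] := mult_domB (uh n) fh; rewrite mf; exact: muN.
Qed.

(** The symbol of [f] acts on [h] as multiplication by [f], whichever operator [xget] picks; so
    [mult_form h], which is closed, extends the form of the vector state. *)
Lemma vector_state_ac h : nc_ac (vector_state h).
Proof.
exists (mult_form h); split.
- exact: mult_form_positive.
- exact: mult_form_closed.
have key f : [set a (hone : H) | a in disk_algebra] f ->
    [/\ disk_algebra (symbol_op f), mult_dom h f & mult h f = symbol_op f h].
  move=> [a da af].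
  have [ds sf] := xgetPex 0 (P := [set a | disk_algebra a /\ a hone = f])
    (ex_intro _ a (conj da af)).
  have [fh mf] : mult_dom h f /\ mult h f = symbol_op f h.
    apply: mult_domP => s; rewrite /symbol_op (cauchy_prod_disk_algebra _ _ ds).
    by rewrite sf.
  by [].
split=> [f /key[]//|f g /key[df fh mf] /key[dg gh mg]] /=.
by rewrite mf mg /vector_state /= inner_adjr //; exact: disk_algebra_bounded.
Qed.

End AbsoluteContinuity.

(** * Comparison of Christoffel numbers at zero *)

Section Christoffel.
Context {R : realType} {d : nat}.
Local Notation C := R[i].
Local Notation H := (hardy R d).
Implicit Types mu nu : (H -> H) -> C.

Lemma positive_evalL (Q : @ncpoly R d) :
  disk_system (adj (evalL Q) \o evalL Q) /\ positive_op (adj (evalL Q) \o evalL Q).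
Proof.
rewrite evalL_polyop; split; last exact: (positive_adj_comp (ncop_of _)).
exact: disk_system_trigop (trigop_adj_comp _ _).
Qed.

Lemma christoffel0_set_neq0 nu : [set complex.Re (nu (adj (evalL Q) \o evalL Q))
  | Q in [set Q : @ncpoly R d | Q [::] = 1]] !=set0.
Proof.
have [Q _ Q1] := @polyop_range R d [:: (1, [::])].
exists (complex.Re (nu (adj (evalL Q) \o evalL Q))); exists Q => //=.
by rewrite -evalL_hone Q1 polyop_id.
Qed.

Lemma christoffel0_ge nu (x : R) :
  (forall Q : @ncpoly R d, Q [::] = 1 ->
     x <= complex.Re (nu (adj (evalL Q) \o evalL Q))) -> x <= christoffel0 nu.
Proof.
move=> xQ; apply: lb_le_inf; first exact: christoffel0_set_neq0.
by move=> _ [Q /= Q1 <-]; exact: xQ.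
Qed.

Lemma christoffel0_le nu (Q : @ncpoly R d) : nc_measure nu -> Q [::] = 1 ->
  christoffel0 nu <= complex.Re (nu (adj (evalL Q) \o evalL Q)).
Proof.
move=> hnu Q1.
pose a : ncop R d := ncop_of [seq (Q w, w) | w <- finsupp Q].
have aE : (a : H -> H) = evalL Q by rewrite evalL_polyop.
have /(christoffel0_bounds hnu)/andP[_] : const_coef a = 1.
  by rewrite /const_coef aE evalL_hone.
by rewrite /gns_form aE.
Qed.

Lemma christoffel0_ge0 nu : nc_measure nu -> 0 <= christoffel0 nu.
Proof.
move=> hnu; apply: christoffel0_ge => Q _; have [dQ pQ] := positive_evalL Q.
exact: ge0_Re (nc_measure_ge0 hnu dQ pQ).
Qed.

Lemma le_christoffel0 mu nu : nc_measure mu -> nc_measure nu ->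
  nc_measure_le nu mu -> christoffel0 nu <= christoffel0 mu.
Proof.
move=> hmu hnu numu; apply: christoffel0_ge => Q Q1.
apply: le_trans (christoffel0_le hnu Q1) _; have [dQ pQ] := positive_evalL Q.
have := numu _ dQ pQ.
by rewrite ge0_le_Re //; [exact: nc_measure_ge0 dQ pQ..].
Qed.

Lemma ac_below_same_christoffel0 mu : nc_measure mu -> 0 < christoffel0 mu ->
  exists nu, [/\ nc_measure nu, nc_ac nu, nc_measure_le nu mu &
    christoffel0 mu <= christoffel0 nu].
Proof.
move=> hmu lam0; have [w [cw wmin]] := christoffel0_minimizing hmu.
have gP := gns_semi_inner hmu.
have gS := gns_nshift hmu.
have gle := christoffel0_const_coef hmu.
have nl := @nshift_linear R d; have cl := @const_coef_scalar R d.
have c0 := @const_coef_nshift R d.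
pose h := wold_map gP nl gS cl c0 lam0 gle cw wmin ncop1.
have h0 : h [::] = (Num.sqrt (christoffel0 mu))%:C.
  by rewrite wold_map_nil const_coef1 mulr1.
exists (vector_state h); split.
- exact: vector_state_measure.
- exact: vector_state_ac.
- apply: (vector_state_le hmu) => l l0; rewrite polyopE.
  have := wold_accretive gP nl gS cl c0 lam0 gle cw wmin ncop1 l0.
  rewrite (_ : polyV nshift l ncop1 = ncop_of l) //.
  by apply: val_inj; rewrite /= opval_polyV opval1.
apply: christoffel0_ge => Q Q1.
have bQ : bounded_op (evalL Q) by rewrite evalL_polyop; exact: bounded_polyop.
rewrite /vector_state -[(_ \o _) h]/(adj (evalL Q) (evalL Q h)).
rewrite inner_adjr // -sqr_hnorm.
have : normc (evalL Q h [::]) <= hnorm (evalL Q h) := coef_le _ _.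
(* The empty word has a single cut, so the constant coefficient of [Q h] is [Q [::] * h [::]]. *)
rewrite evalL_polyop cauchy_prod_polyop -evalL_polyop /cauchy_prod big_ord1.
rewrite evalL_hone Q1 mul1r h0 normc_real ger0_norm ?sqrtr_ge0 // => le_h.
rewrite -[leLHS](sqr_sqrtr (ltW lam0)) ler_sqr ?nnegrE ?sqrtr_ge0 //.
Qed.

End Christoffel.

Theorem corollary5p10 (R : realType) (d : nat)
    (mu mu_ac mu_s : (hardy R d -> hardy R d) -> R[i])
    (hd : (1 <= d)%N)
    (hmu : nc_measure mu)
    (hprob : mu idfun = 1)
    (hnt : nontrivial mu)
    (hdec : nc_lebesgue_decomposition mu mu_ac mu_s) :
  christoffel0 mu = christoffel0 mu_ac.
Proof.
have [[hac _] _ [_ acmu] acmax _] := hdec.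
have ge0 := christoffel0_ge0 hmu.
apply/le_anti/andP; split; last exact: le_christoffel0.
(* The construction divides by [Num.sqrt lam]; when the number is 0, nonnegativity of the other side
   already suffices. *)
move: ge0; rewrite le0r => /orP[/eqP ->|lam0]; first exact: christoffel0_ge0.
have [nu [hnu nuac numu lenu]] := ac_below_same_christoffel0 hmu lam0.
exact: le_trans lenu (le_christoffel0 hac hnu (acmax _ hnu nuac numu)).
Qed.
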